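(* Suppose that Assumptions (I), (II), (III) and the nondegeneracy condition (N) of the context hold, and that the limit $G(\widehat\varepsilon)=\lim_{\varepsilon\searrow\widehat\varepsilon}G(\varepsilon)$ exists and is different from $0$. Then there is a positive constant $\gamma$ such that $$\mathrm{Re}\,\lambda(\varepsilon)=\gamma\,\sqrt{\varepsilon-\widehat\varepsilon}\;(1+o(1))\qquad\text{as }\varepsilon\searrow\widehat\varepsilon .$$
   Context: Setting. $A\in\mathbb{R}^{n\times n}$ (all eigenvalues with negative real part), $B\in\mathbb{R}^{n\times m}$, $C\in\mathbb{R}^{p\times n}$, $D\in\mathbb{R}^{p\times m}$, and $X=\begin{pmatrix}A&B\\ C&D\end{pmatrix}\in\mathbb{R}^{(n+p)\times(n+m)}$. $M(X)\in\mathbb{R}^{2n\times 2n}$ is one of the following two Hamiltonian matrices: either (for $p=m$ and $D+D^\top$ positive definite) $$M_p(X)=\begin{pmatrix}A&0\\ 0&-A^\top\end{pmatrix}-\begin{pmatrix}B\\ -C^\top\end{pmatrix}(D+D^\top)^{-1}\begin{pmatrix}C^\top\\ B\end{pmatrix}^\top,$$ or (for $I-D^\top D$ positive definite) $$M_b(X)=\begin{pmatrix}A&0\\ -C^\top C&-A^\top\end{pmatrix}+\begin{pmatrix}B\\ -C^\top D\end{pmatrix}(I-D^\top D)^{-1}\begin{pmatrix}C^\top D\\ B\end{pmatrix}^\top.$$ (A real matrix $N\in\mathbb R^{2n\times 2n}$ is Hamiltonian if $JN$ is symmetric, where $J=\begin{pmatrix}0&I_n\\ -I_n&0\end{pmatrix}$.)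 All matrices $X+L[\varepsilon E]$ that occur are assumed to lie in the domain of definition of $M$. $L:\mathbb{R}^{k\times l}\to\mathbb{R}^{(n+p)\times(n+m)}$ is a given linear map and $L^\ast$ its adjoint with respect to the Frobenius inner product $\langle U,V\rangle=\mathrm{tr}(U^\top V)$; $M'(X)^\ast$ is the adjoint of the derivative $M'(X):\mathbb{R}^{(n+p)\times(n+m)}\to\mathbb{R}^{2n\times 2n}$. For a real Hamiltonian matrix $N$, $\lambda(N)$ is the eigenvalue of minimal nonnegative real part (chosen with largest, nonnegative imaginary part), and $\phi_\varepsilon(E)=\mathrm{Re}\,\lambda(M(X+L[\varepsilon E]))$. For each $\varepsilon>0$ under consideration, $E(\varepsilon)\in\mathbb{R}^{k\times l}$ of unit Frobenius norm is a local maximizer of $\phi_\varepsilon$ on the unit sphere $\{\|E\|_F=1\}$. Put $M(\varepsilon)=M(X+L[\varepsilon E(\varepsilon)])$, $\lambda(\varepsilon)=\lambda(M(\varepsilon))$, $f(\varepsilon)=\phi_\varepsilon(E(\varepsilon))=\mathrm{Re}\,\lambda(\varepsilon)$, and let $x(\varepsilon),y(\varepsilon)$ be left and right eigenvectors of $M(\varepsilon)$ to $\lambda(\varepsilon)$ with $\|x(\varepsilon)\|=\|y(\varepsilon)\|=1$ and $x(\varepsilon)^*y(\varepsilon)$ real and positive (for $\varepsilon>\widehat\varepsilon$). Put $$G(\varepsilon)=L^\ast\bigl[M'(X+L[\varepsilon E(\varepsilon)])^\ast[\mathrm{Re}(x(\varepsilon)y(\varepsilon)^* )]\bigr]\in\mathbb{R}^{k\times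 l}.$$ The number $\widehat\varepsilon$ is such that $f(\varepsilon)=0$ for $0<\varepsilon\le\widehat\varepsilon$ and $f(\varepsilon)>0$ for $\varepsilon>\widehat\varepsilon$ near $\widehat\varepsilon$; moreover $f(\varepsilon)\to0$ as $\varepsilon\searrow\widehat\varepsilon$. Assumption (I): there is $\bar\varepsilon>\widehat\varepsilon$ such that for $\varepsilon\in(\widehat\varepsilon,\bar\varepsilon)$ the eigenvalue $\lambda(\varepsilon)$ of smallest positive real part with nonnegative imaginary part of $M(\varepsilon)$ is unique and simple, and $E(\varepsilon)$ and $\lambda(\varepsilon)$ are smooth functions of $\varepsilon$ there. Assumption (II): $G(\varepsilon)\ne0$ for $\varepsilon\in(\widehat\varepsilon,\bar\varepsilon)$. Assumption (III): the limit $M(\widehat\varepsilon):=\lim_{\varepsilon\searrow\widehat\varepsilon}M(\varepsilon)$ exists, and the purely imaginary eigenvalue $\lambda(\widehat\varepsilon)=\lim_{\varepsilon\searrow\widehat\varepsilon}\lambda(\varepsilon)$ of $M(\widehat\varepsilon)$ has algebraic multiplicity two and is defective (that is, the zero singular value of $M(\widehat\varepsilon)-\lambda(\widehat\varepsilon)I$ is simple). Condition (N): for $\varepsilon\in(\widehat\varepsilon,\bar\varepsilon)$, $M(\varepsilon)$ has no imaginary eigenvalues and hence there is an orthogonal symplectic real matrix $S(\varepsilon)$ (i.e. $S^\top S=I$, $S^\top JS=J$) giving a real Schur–Hamiltonian decomposition $$S(\varepsilon)^{-1}M(\varepsilon)S(\varepsilon)=\begin{pmatrix}F(\varepsilon)&H(\varepsilon)\\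 0&-F(\varepsilon)^\top\end{pmatrix}$$ with $H(\varepsilon)$ symmetric and $F(\varepsilon)$ upper quasi-triangular, where $\lambda(\varepsilon)$ is an eigenvalue of $F(\varepsilon)$ (so that the lower half of $S(\varepsilon)^{-1}y(\varepsilon)$ vanishes). Fix such $S(\varepsilon)$ and write $S(\varepsilon)^\top x(\varepsilon)=\begin{pmatrix}-s(\varepsilon)\\ r(\varepsilon)\end{pmatrix}$ with $s(\varepsilon),r(\varepsilon)\in\mathbb{C}^n$. Condition (N) is $$\liminf_{\varepsilon\searrow\widehat\varepsilon}\left|\left(\frac{s(\varepsilon)}{\|s(\varepsilon)\|}\right)^{*}\frac{r(\varepsilon)}{\|r(\varepsilon)\|}\right|>0 .$$ *)

(* Defs.v *)
From HB Require Import structures.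
From mathcomp Require Import all_boot all_order all_algebra.
From mathcomp Require Import complex.
From mathcomp Require Import all_classical all_reals all_analysis.

Set Implicit Arguments.
Unset Strict Implicit.
Unset Printing Implicit Defensive.

Import Order.TTheory GRing.Theory Num.Theory.
Import numFieldNormedType.Exports.

Local Open Scope classical_set_scope.
Local Open Scope ring_scope.
Local Open Scope sesquilinear_scope.

Definition frob (R : realType) (k l : nat) (U V : 'M[R]_(k, l)) : R :=
  \tr (U^T *m V).

Definition fnorm (R : realType) (k l : nat) (U : 'M[R]_(k, l)) : R :=
  Num.sqrt (frob U U).

(* The Frobenius adjoint of f, which is meant to be linear; its defining
   property is [frob_adjmx]. *)
Definition adjmx (R : realType) (k l r s : nat)
    (f : 'M[R]_(k, l) -> 'M[R]_(r, s)) (V : 'M[R]_(r, s)) : 'M[R]_(k, l) :=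
  \matrix_(i, j) frob (f (delta_mx i j)) V.

Lemma frob_adjmx (R : realType) (k l r s : nat)
    (f : {linear 'M[R]_(k, l) -> 'M[R]_(r, s)})
    (U : 'M[R]_(k, l)) (V : 'M[R]_(r, s)) :
  frob (f U) V = frob U (adjmx f V).
Proof.
rewrite [in LHS](matrix_sum_delta U) linear_sum /frob.
under eq_bigr do rewrite linear_sum.
rewrite linear_sum mulmx_suml linear_sum [RHS]/mxtrace.
under [RHS]eq_bigr do rewrite mxE.
rewrite [RHS]exchange_big /=; apply: eq_bigr => i _.
rewrite linear_sum mulmx_suml linear_sum; apply: eq_bigr => j _.
by rewrite !linearZ -scalemxAl linearZ !mxE.
Qed.

Definition posdefmx (R : realType) (n : nat) (Q : 'M[R]_n) : Prop :=
  Q^T = Q /\ forall v : 'cV[R]_n, v != 0 -> 0 < (v^T *m Q *m v) 0 0.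

Definition symplJ (R : realType) (n : nat) : 'M[R]_(n + n) :=
  block_mx 0 1%:M (- 1%:M) 0.

Definition hamiltonian (R : realType) (n : nat) (N : 'M[R]_(n + n)) : Prop :=
  (symplJ R n *m N)^T = symplJ R n *m N.

Definition orthosymplectic (R : realType) (n : nat) (S : 'M[R]_(n + n)) : Prop :=
  S^T *m S = 1%:M /\ S^T *m symplJ R n *m S = symplJ R n.

(* Upper triangular up to diagonal blocks of size 1 or 2: nothing below the
   first subdiagonal, and no two adjacent nonzero subdiagonal entries. *)
Definition quasi_triangular (R : realType) (n : nat) (F : 'M[R]_n) : Prop :=
  (forall i j : 'I_n, (j.+1 < i)%N -> F i j = 0) /\
  (forall i j h : 'I_n, i = j.+1 :> nat -> j = h.+1 :> nat ->
     F i j = 0 \/ F j h = 0).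

Definition ham_p (R : realType) (n m : nat) (X : 'M[R]_(n + m, n + m)) :
    'M[R]_(n + n) :=
  let A := ulsubmx X in let B := ursubmx X in
  let C := dlsubmx X in let D := drsubmx X in
  block_mx A 0 0 (- A^T)
  - col_mx B (- C^T) *m invmx (D + D^T) *m (col_mx C^T B)^T.

Definition ham_b (R : realType) (n m p : nat) (X : 'M[R]_(n + p, n + m)) :
    'M[R]_(n + n) :=
  let A := ulsubmx X in let B := ursubmx X in
  let C := dlsubmx X in let D := drsubmx X in
  block_mx A 0 (- (C^T *m C)) (- A^T)
  + col_mx B (- (C^T *m D)) *m invmx (1%:M - D^T *m D) *m (col_mx (C^T *m D) B)^T.

(* An indexed type, because ham_p only makes sense for p = m. *)
Inductive ham_kind : nat -> nat -> Type :=
  | KindP (m : nat) : ham_kind m m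
  | KindB (m p : nat) : ham_kind m p.

Definition ham_mx (R : realType) (n m p : nat) (K : ham_kind m p) :
    'M[R]_(n + p, n + m) -> 'M[R]_(n + n) :=
  match K in ham_kind m p return 'M[R]_(n + p, n + m) -> 'M[R]_(n + n) with
  | KindP m => @ham_p R n m
  | KindB m p => @ham_b R n m p
  end.

(* [invmx] makes [ham_mx K] total; [ham_dom K] is the open set on which it is
   the intended map. *)
Definition ham_dom (R : realType) (n m p : nat) (K : ham_kind m p) :
    'M[R]_(n + p, n + m) -> Prop :=
  match K in ham_kind m p return 'M[R]_(n + p, n + m) -> Prop with
  | KindP m => fun X => posdefmx (drsubmx X + (drsubmx X)^T)
  | KindB m p => fun X => posdefmx (1%:M - (drsubmx X)^T *m drsubmx X)
  end.

Lemma symplJ_mul (R : realType) (n q : nat) (a b c d : 'M[R]_n)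
    (u v : 'M[R]_(n, q)) (Q : 'M[R]_q) (w z : 'M[R]_(q, n)) :
  symplJ R n *m (block_mx a b c d + col_mx u v *m Q *m row_mx w z) =
  block_mx (c + v *m Q *m w) (d + v *m Q *m z)
    (- (a + u *m Q *m w)) (- (b + u *m Q *m z)).
Proof.
rewrite (mul_col_mx u v Q) (mul_col_row (u *m Q)) add_block_mx /symplJ.
by rewrite mulmx_block !mul0mx !mul1mx !mulNmx !mul1mx !add0r !addr0.
Qed.

Lemma ham_mx_hamiltonian (R : realType) (n m p : nat) (K : ham_kind m p)
    (X : 'M[R]_(n + p, n + m)) : hamiltonian (ham_mx K X).
Proof.
rewrite /hamiltonian; case: K X => [q|q r] X /=.
  rewrite /ham_p; set A := ulsubmx X; set B := ursubmx X; set C := dlsubmx X.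
  set Q := invmx _; have Qs : Q^T = Q.
    by rewrite /Q trmx_inv linearD /= trmxK addrC.
  rewrite -mulNmx -mulNmx opp_col_mx opprK (tr_col_mx C^T B) trmxK symplJ_mul.
  rewrite !mulNmx !add0r !opprK tr_block_mx.
  by congr block_mx; rewrite ?linearN /= ?linearD /= ?linearN /=;
    do 3 rewrite ?linearN /= ?(trmx_mul, trmxK, Qs, mulmxA, opprD, opprK).
rewrite /ham_b; set A := ulsubmx X; set B := ursubmx X; set C := dlsubmx X.
set D := drsubmx X; set Q := invmx _; have Qs : Q^T = Q.
  by rewrite /Q trmx_inv linearB /= trmx_mul trmxK trmx1.
rewrite (tr_col_mx _ B) symplJ_mul tr_block_mx !mulNmx !add0r.
by congr block_mx; rewrite ?linearN /= ?linearD /= ?linearN /=;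
  do 3 rewrite ?linearN /= ?(trmx_mul, trmxK, Qs, mulmxA, mulNmx, opprD, opprK).
Qed.

Definition cplxmx (R : realType) (m n : nat) (N : 'M[R]_(m, n)) : 'M[R[i]]_(m, n) :=
  map_mx (real_complex R) N.

Definition cnorm (R : realType) (n : nat) (v : 'cV[R[i]]_n) : R :=
  Num.sqrt (\sum_i complex.Re `|v i 0| ^+ 2).

Definition alg_mult (R : realType) (n : nat) (N : 'M[R]_n) (mu : R[i]) : nat :=
  mup mu (char_poly (cplxmx N)).

Definition geom_mult (R : realType) (n : nat) (N : 'M[R]_n) (mu : R[i]) : nat :=
  \rank (eigenspace (cplxmx N) mu).

Definition defective (R : realType) (n : nat) (N : 'M[R]_n) (mu : R[i]) : Prop :=
  (geom_mult N mu < alg_mult N mu)%N.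

Definition is_lead_eig (R : realType) (n : nat) (N : 'M[R]_n) (mu : R[i]) : Prop :=
  [/\ eigenvalue (cplxmx N) mu,
      0 <= complex.Re mu,
      0 <= complex.Im mu &
      forall nu : R[i], eigenvalue (cplxmx N) nu -> 0 <= complex.Re nu ->
        complex.Re mu <= complex.Re nu /\
        (complex.Re nu = complex.Re mu -> complex.Im nu <= complex.Im mu)].

(* lambda(N): minimal nonnegative real part, then maximal imaginary part (which
   is nonnegative since N is real). The default value of xget is not used when N is
   Hamiltonian of positive size, see [lead_eigP]. *)
Definition lead_eig (R : realType) (n : nat) (N : 'M[R]_n) : R[i] :=
  xget 0 [set mu | is_lead_eig N mu].

Lemma is_lead_eig_uniq (R : realType) (n : nat) (N : 'M[R]_n) (mu nu : R[i]) :
  is_lead_eig N mu -> is_lead_eig N nu -> mu = nu.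
Proof.
case: mu nu => [a b] [c d] [emu a0 b0 mmu] [enu c0 d0 mnu]; move: a0 b0 c0 d0.
have := mmu _ enu; have := mnu _ emu => /= h1 h2 a0 b0 c0 d0.
have [{h1}ca h1] := h1 a0; have [{h2}ac h2] := h2 c0.
have eac : a = c by apply: le_anti; rewrite ac ca.
by rewrite eac; congr Complex; apply: le_anti; rewrite h1 // h2.
Qed.

Lemma eigenvalue_det (F : fieldType) (n : nat) (N : 'M[F]_n) (a : F) :
  eigenvalue N a = (\det (N - a%:M) == 0).
Proof.
by rewrite /eigenvalue /eigenspace kermx_eq0 row_free_unit unitmxE unitfE negbK.
Qed.

Lemma eigenvalue_cplxmx_conj (R : realType) (n : nat) (N : 'M[R]_n) (mu : R[i]) :
  eigenvalue (cplxmx N) mu -> eigenvalue (cplxmx N) (conjc mu).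
Proof.
rewrite !eigenvalue_det => /eqP d0.
have -> : cplxmx N - (conjc mu)%:M = map_mx conjc (cplxmx N - mu%:M).
  rewrite map_mxB map_scalar_mx; congr (_ - _).
  by apply/matrixP => i j; rewrite !mxE [RHS]conjc_real.
by rewrite det_map_mx d0 rmorph0.
Qed.

Lemma eigenvalue_cplxmx_opp (R : realType) (n : nat) (N : 'M[R]_(n + n)) (mu : R[i]) :
  hamiltonian N -> eigenvalue (cplxmx N) mu -> eigenvalue (cplxmx N) (- mu).
Proof.
move=> hN; rewrite !eigenvalue_det => /eqP d0.
have JT : (symplJ R n)^T = - symplJ R n.
  by rewrite /symplJ tr_block_mx opp_block_mx !linearN /= !trmx0 trmx1 !oppr0 opprK.
have JJ : symplJ R n *m symplJ R n = - 1%:M.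
  rewrite /symplJ mulmx_block !mul0mx !mulmx0 !mul1mx mulmx1 !addr0 !add0r.
  by rewrite scalar_mx_block opp_block_mx oppr0.
pose Jc := cplxmx (symplJ R n).
have JcN : Jc *m (cplxmx N - mu%:M) = - ((cplxmx N - (- mu)%:M)^T *m Jc).
  have : Jc *m cplxmx N = - ((cplxmx N)^T *m Jc).
    rewrite /Jc /cplxmx map_trmx -!map_mxM -map_mxN /=; congr map_mx.
    by rewrite -hN trmx_mul JT mulmxN.
  rewrite mulmxBr => ->; rewrite linearB /= tr_scalar_mx mulmxBl opprB.
  by rewrite !scalar_mxC !mul_scalar_mx scaleNr addrC.
have uJ : \det Jc != 0.
  have : \det (Jc *m Jc) != 0.
    rewrite /Jc -map_mxM JJ map_mxN map_mx1 -scaleN1r detZ det1 mulr1.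
    by rewrite expf_neq0 // oppr_eq0 oner_eq0.
  by rewrite det_mulmx mulf_eq0 negb_or => /andP[].
have := congr1 (fun Q => \det Q) JcN => /=.
rewrite det_mulmx d0 mulr0 -scaleN1r detZ det_mulmx det_tr => /esym/eqP.
by rewrite !mulf_eq0 (negPf uJ) orbF expf_eq0 oppr_eq0 oner_eq0 andbF.
Qed.

Lemma lead_eigP (R : realType) (n : nat) (N : 'M[R]_(n + n)) :
  (0 < n)%N -> hamiltonian N -> is_lead_eig N (lead_eig N).
Proof.
move=> n0 hN; rewrite /lead_eig; case: xgetP => [mu _ //|no].
exfalso; pose P := char_poly (cplxmx N).
have sP : size P != 1%N by rewrite size_char_poly; case: (n) n0.
have [mu0 /[dup] /eqP r0] := closed_rootP P sP.
rewrite -eigenvalue_root_char => e0.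
have [s Ps] := closed_field_poly_normal P.
have sE z : (z \in s) = eigenvalue (cplxmx N) z.
  rewrite eigenvalue_root_char -/P Ps (monicP (char_poly_monic _)) scale1r.
  by rewrite root_prod_XsubC.
pose t := [seq z <- s | 0 <= complex.Re z].
have tE z : (z \in t) = eigenvalue (cplxmx N) z && (0 <= complex.Re z).
  by rewrite mem_filter sE andbC.
pose r (z w : R[i]) := (complex.Re z < complex.Re w) ||
   ((complex.Re z == complex.Re w) && (complex.Im w <= complex.Im z)).
have rT : transitive r.
  move=> b a c /orP[ab|/andP[/eqP ab ab']] /orP[bc|/andP[/eqP bc bc']]; rewrite /r.
  - by rewrite (lt_trans ab bc).
  - by rewrite -bc ab.
  - by rewrite ab bc.
  - by rewrite ab bc eqxx (le_trans bc' ab') orbT.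
have rt a b : r a b || r b a.
  by rewrite /r; case: ltgtP => //= _; exact: le_total.
have [w wt] : exists w, w \in t.
  have [h|h] := leP 0 (complex.Re mu0); first by exists mu0; rewrite tE e0 h.
  exists (- mu0); rewrite tE eigenvalue_cplxmx_opp //=.
  by case: (mu0) h => a b /= h; rewrite oppr_ge0 ltW.
have [m mt mmin] : exists2 m, m \in t & forall z, z \in t -> r m z.
  have st : size (sort r t) = size t by rewrite size_sort.
  have : sorted r (sort r t) by apply: sort_sorted.
  have ms z : (z \in sort r t) = (z \in t) by rewrite mem_sort.
  case: (sort r t) ms => [|m u] ms; first by rewrite -ms in wt.
  rewrite /= (path_sortedE rT) => /andP[/allP mu _].
  exists m; first by rewrite -ms mem_head.
  move=> z; rewrite -ms inE => /orP[/eqP->|/mu //].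
  by have := rt m m; rewrite orbb.
move: (mt); rewrite tE => /andP[em m0].
apply: (no m); split => //.
- have : conjc m \in t.
    by rewrite tE eigenvalue_cplxmx_conj //; case: (m) m0.
  move=> /mmin; rewrite /r; case: (m) => a b /=; rewrite ltxx eqxx /=.
  by rewrite -subr_ge0 opprK -mulr2n pmulrn_lge0.
- move=> nu enu nu0; have : nu \in t by rewrite tE enu.
  move=> /mmin /orP[h|/andP[/eqP -> h]]; last by [].
  by split; [exact: ltW|move=> e; rewrite e ltxx in h].
Qed.

Definition smooth_on (R : realType) (V : normedModType R) (f : R -> V) (a b : R) :
    Prop :=
  forall (j : nat) (t : R), a < t < b -> derivable (derive1n j f) t 1.

Definition sphere_local_max (R : realType) (k l : nat) (phi : 'M[R]_(k, l) -> R)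
    (E : 'M[R]_(k, l)) : Prop :=
  fnorm E = 1 /\ \forall E' \near E, fnorm E' = 1 -> phi E' <= phi E.

Definition Mpert (R : realType) (n m p k l : nat) (K : ham_kind m p)
    (X : 'M[R]_(n + p, n + m)) (L : 'M[R]_(k, l) -> 'M[R]_(n + p, n + m))
    (e : R) (E : 'M[R]_(k, l)) : 'M[R]_(n + n) :=
  ham_mx K (X + L (e *: E)).

Definition phi (R : realType) (n m p k l : nat) (K : ham_kind m p)
    (X : 'M[R]_(n + p, n + m)) (L : 'M[R]_(k, l) -> 'M[R]_(n + p, n + m))
    (e : R) (E : 'M[R]_(k, l)) : R :=
  complex.Re (lead_eig (Mpert K X L e E)).

(* The matrix G = L^* [ M'(X + L[e E])^* [ Re (x y^* ) ] ] *)
Definition gradG (R : realType) (n m p k l : nat) (K : ham_kind m p)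
    (X : 'M[R]_(n + p, n + m)) (L : 'M[R]_(k, l) -> 'M[R]_(n + p, n + m))
    (e : R) (E : 'M[R]_(k, l)) (x y : 'cV[R[i]]_(n + n)) : 'M[R]_(k, l) :=
  adjmx L (adjmx ('d (@ham_mx R n m p K) (X + L (e *: E)))
    (map_mx (@complex.Re R) (x *m y ^t*))).

(* x and y are left and right eigenvectors, normalized so that x^* y > 0;
   the order of R[i] makes positive numbers real. *)
Definition normalized_eigenpair (R : realType) (n : nat) (N : 'M[R]_n)
    (mu : R[i]) (x y : 'cV[R[i]]_n) : Prop :=
  [/\ x ^t* *m cplxmx N = mu *: x ^t*,
      cplxmx N *m y = mu *: y,
      cnorm x = 1, cnorm y = 1 &
      0 < (x ^t* *m y) 0 0].

Definition schur_hamiltonian (R : realType) (n : nat) (N S : 'M[R]_(n + n))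
    (F H : 'M[R]_n) : Prop :=
  [/\ orthosymplectic S,
      invmx S *m N *m S = block_mx F H 0 (- F^T),
      H^T = H &
      quasi_triangular F].

(* With S^T x = (-s; r), the number |(s / |s|)^* (r / |r|)|. *)
Definition nondeg (R : realType) (n : nat) (S : 'M[R]_(n + n))
    (x : 'cV[R[i]]_(n + n)) : R :=
  let z := (cplxmx S)^T *m x in
  let s := - usubmx z in
  let r := dsubmx z in
  complex.Re `|((((cnorm s)^-1)%:C%C *: s) ^t* *m (((cnorm r)^-1)%:C%C *: r)) 0 0|.

(* Main.v *)
Require Import Defs.
From HB Require Import structures.
From mathcomp Require Import all_boot all_order all_algebra.
From mathcomp Require Import complex.
From mathcomp Require Import all_classical all_reals all_analysis.
From mathcomp Require Import ring lra.

Set Implicit Arguments.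
Unset Strict Implicit.
Unset Printing Implicit Defensive.

Import Order.TTheory GRing.Theory Num.Theory.
Import numFieldNormedType.Exports.

Local Open Scope classical_set_scope.
Local Open Scope ring_scope.

(** Write f = Re lambda and r = x^* y > 0.  The proof computes the limit of
f f' and shows that it is a positive number, so that f^2 grows linearly.

The derivative of f.  Perturbing a simple eigenvalue gives
f' = <G, E + e E'> / r.  Since E maximizes on the unit sphere, G is parallel
to E ([maximizer_gradient_parallel]), and <E, E'> = 0 because E stays on the
sphere; hence f' = <G, E> / r and <G, E>^2 = |G|^2.  Thus
(f f')^2 = (f / r)^2 |G|^2, and the sign of <G, E> is left open.

The ratio f / r.  Put W = lambda - M(e), with characteristic polynomial chi of
M(e).  Then adj W y = chi'(lambda) y ([adj_eigenvector]), and adj W has rank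
one with row space spanned by x^*, which together give
|adj W|_F r = |chi'(lambda)| ([adj_norm_overlap]).  By the Hamiltonian
symmetry, - conj lambda is a second root of chi, at distance 2 f from lambda,
so that chi'(lambda) is 2 f times a quantity that tends to half the second
derivative of the limiting characteristic polynomial at lambda(ehat); this is
nonzero because the multiplicity there is exactly two.  On the other side
adj W tends to the adjugate of the limiting matrix, which is nonzero because
the double eigenvalue is defective, i.e. the rank drops by one only.
Therefore (f / r)^2 has a positive limit ([overlap_asymptotics]).

Conclusion.  (f f')^2 has a positive limit, f f' is continuous and so keeps a
constant sign near ehat, and this sign is positive because f is positive and
tends to 0.  Integrating 2 f f' = (f^2)' by the mean value theorem gives
f^2 / (e - ehat) --> gamma^2 ([sqrt_growth]).

Two tools avoid the differentiation of eigenvectors and the general theory of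
continuity of roots.  For an eigenvalue mu_t of N_t close to lambda, the
columns of adj (mu_t - N_t) are exact eigenvectors of N_t which depend
continuously on t; paired with x they yield the difference quotient of mu_t
([eigenvalue_difference_quotient]).  And in the maximization argument the
leading eigenvalue of a competitor lies, by maximality itself, in the strip
0 <= Re <= f, where lambda is the only eigenvalue in the limit
([cvg_root_in_strip]). *)

Local Open Scope sesquilinear_scope.

(** * Adjugates at an eigenvalue *)

(** Apply the adjugate of the polynomial matrix 'X - N to the constant vector
    y: since ('X - N) y = ('X - a) y, this gives ('X - a) (adj y) = char_poly y,
    and differentiating at a leaves only the derivative of char_poly. *)
Lemma adj_eigenvector (F : fieldType) (n : nat) (N : 'M[F]_n) (y : 'cV[F]_n) (a : F) :
  N *m y = a *: y -> \adj (a%:M - N) *m y = (char_poly N)^`().[a] *: y.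
Proof.
move=> Ny; pose Y := map_mx polyC y.
have cY : char_poly_mx N *m Y = ('X - a%:P) *: Y.
  by rewrite mulmxBl mul_scalar_mx -map_mxM Ny map_mxZ scalerBl.
have W : ('X - a%:P) *: (\adj (char_poly_mx N) *m Y) = char_poly N *: Y.
  by rewrite scalemxAr -cY mulmxA mul_adj_mx mul_scalar_mx.
have aE : a%:M - N = map_mx (horner_eval a) (char_poly_mx N).
  rewrite map_mxB map_scalar_mx /= /horner_eval hornerX; congr (_ - _).
  by apply/matrixP => i j; rewrite !mxE /horner_eval hornerC.
have yE : y = map_mx (horner_eval a) Y.
  by apply/matrixP => i j; rewrite !mxE /horner_eval hornerC.
rewrite [in LHS]yE aE -map_mx_adj -map_mxM.
apply/matrixP => i j; have /matrixP/(_ i j) := W.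
rewrite !mxE => /(congr1 (fun p => p^`().[a])).
rewrite !derivM derivXsubC derivC mul1r mulr0 addr0 hornerD !hornerM hornerC.
by rewrite hornerXsubC subrr mul0r addr0.
Qed.

Lemma adj_eq0_rank (F : fieldType) (n : nat) (W : 'M[F]_n) :
  (\rank W < n.-1)%N -> \adj W = 0.
Proof.
move=> rW; apply/matrixP => i j; rewrite !mxE /cofactor.
suff -> : \det (row' j (col' i W)) = 0 by rewrite mulr0.
apply/eqP; apply: contraTT rW => /negPf d0; rewrite -leqNgt.
have /mxrank_unit <- : row' j (col' i W) \in unitmx by rewrite unitmxE unitfE d0.
rewrite row'Esub; apply: leq_trans (mxrankS (rowsub_sub _ _)) _.
rewrite -mxrank_tr tr_col' row'Esub -(mxrank_tr W).
exact/mxrankS/rowsub_sub.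
Qed.

(** The rows of adj W lie in the left kernel of W, which is the line of x. *)
Lemma adj_rank1 (F : fieldType) (n : nat) (W : 'M[F]_n) (x : 'rV[F]_n) :
  \rank W = n.-1 -> x != 0 -> x *m W = 0 -> exists a : 'cV[F]_n, \adj W = a *m x.
Proof.
move=> rW x0 xW; case: n W x rW x0 xW => [|n] W x rW x0 xW.
  by rewrite (thinmx0 x) eqxx in x0.
have dW : \det W = 0.
  apply/eqP; rewrite -[_ == 0]negbK -unitfE -unitmxE -row_free_unit /row_free rW.
  by rewrite neq_ltn ltnSn.
have sx : (x <= kermx W)%MS by apply/sub_kermxP.
have rk : \rank (kermx W) = 1%N by rewrite mxrank_ker rW /= subSnn.
have sk : (kermx W <= x)%MS.
  by rewrite -(geq_leqif (mxrank_leqif_sup sx)) rk lt0n mxrank_eq0.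
have /submxP [a aE] : (\adj W <= x)%MS.
  by apply: submx_trans sk; apply/sub_kermxP; rewrite mul_adj_mx dW raddf0.
by exists a.
Qed.

(** Choose entries u i and v j that are nonzero in a left and in a right kernel
    vector.  A left kernel vector of the minor without row i and column j,
    extended by 0 at place i, is in the left kernel of W: its product with W is
    supported at j, and vanishes there because v kills it.  The left kernel is
    the line of u, so that the zero at i forces the vector to vanish. *)
Lemma adj_neq0 (F : fieldType) (n : nat) (W : 'M[F]_n) :
  (0 < n)%N -> (n.-1 <= \rank W)%N -> \det W = 0 -> \adj W != 0.
Proof.
case: n W => [//|n] W _ /= rW dW.
have rk : (\rank (kermx W) <= 1)%N by rewrite mxrank_ker leq_subLR addn1.
have /det0P [u u0 uW] : \det W == 0 by rewrite dW.
have /det0P [v v0 vW] : \det W^T == 0 by rewrite det_tr dW.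
have {}vW : W *m v^T = 0 by apply: trmx_inj; rewrite trmx_mul trmxK vW trmx0.
have /rV0Pn [i ui] := u0; have /rV0Pn [j vj] := v0.
suff : cofactor W i j != 0.
  by move=> /eqP c0; apply/eqP => /matrixP /(_ j i); rewrite !mxE.
rewrite mulf_neq0 ?signr_eq0 // -unitfE -unitmxE -row_free_unit -kermx_eq0.
apply/eqP/row_matrixP => h; rewrite row0.
set w := row h _; have wP : w *m row' i (col' j W) = 0.
  by rewrite -row_mul mulmx_ker row0.
pose w' : 'rV_n.+1 := \row_c (if unlift i c is Some d then w 0 d else 0).
have w'l d : w' 0 (lift i d) = w 0 d by rewrite mxE liftK.
have w'i : w' 0 i = 0 by rewrite mxE unlift_none.
(* Row i does not contribute to w' W, as w' vanishes there. *)
have w'W c : c != j -> (w' *m W) 0 c = 0.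
  rewrite eq_sym => /unlift_some [d -> _].
  have /matrixP /(_ 0 d) := wP; rewrite !mxE => wd.
  rewrite (bigD1_ord i) //= w'i mul0r add0r -[RHS]wd.
  by apply: eq_bigr => c' _; rewrite w'l !mxE.
have w'0 : w' *m W = 0.
  have : w' *m W *m v^T = 0 by rewrite -mulmxA vW mulmx0.
  move=> /matrixP /(_ 0 0); rewrite mxE (bigD1 j) //= big1 ?addr0; last first.
    by move=> c cj; rewrite w'W // mul0r.
  rewrite [v^T j 0]mxE [RHS]mxE => /eqP; rewrite mulf_eq0 (negPf vj) orbF => /eqP wj.
  by apply/rowP => c; rewrite [RHS]mxE; have [->|/w'W] := eqVneq c j.
have sk : (kermx W <= u)%MS.
  have su : (u <= kermx W)%MS by apply/sub_kermxP.
  rewrite -(geq_leqif (mxrank_leqif_sup su)); apply: leq_trans rk _.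
  by rewrite lt0n mxrank_eq0.
have /sub_rVP [b w'b] : (w' <= u)%MS by apply: submx_trans sk; apply/sub_kermxP.
have b0 : b = 0.
  have := w'i; rewrite w'b mxE => /eqP; rewrite mulf_eq0 (negPf ui) orbF.
  by move=> /eqP.
by apply/rowP => d; rewrite -w'l w'b b0 scale0r !mxE.
Qed.

Lemma nderivn_mulXsubC (F : fieldType) (g : {poly F}) (a : F) (j : nat) :
  (g * ('X - a%:P))^`N(j.+1).[a] = g^`N(j).[a].
Proof.
have -> : g * ('X - a%:P) = g * 'X + 0%:P - a *: g.
  by rewrite mulrBr addr0 -mul_polyC [a%:P * g]mulrC.
rewrite nderivnB nderivnMXaddC nderivnZ hornerD hornerN hornerD hornerZ.
by rewrite hornerMX mulrC addrK.
Qed.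

Lemma nderivn_mup (F : fieldType) (q : {poly F}) (a : F) :
  q != 0 -> q^`N(mup a q).[a] != 0.
Proof.
move=> q0; have := leqnn (mup a q); rewrite mup_geq // => /dvdpP [g gE].
have -> : q^`N(mup a q).[a] = g.[a].
  rewrite [in X in X^`N(_)]gE; elim: (mup a q) g {gE} => [|j IH] g.
    by rewrite mulr1 nderivn0.
  by rewrite exprSr mulrA nderivn_mulXsubC IH.
apply/negP; rewrite -/(root g a) => /factor_theorem [h hE].
have : (mup a q < mup a q)%N.
  by rewrite mup_geq // [X in _ %| X]gE hE -mulrA -exprS dvdp_mulIr.
by rewrite ltnn.
Qed.

(** Taylor expansion at a, evaluated at the other root a + h, divided by h. *)
Lemma deriv_two_roots (F : fieldType) (q : {poly F}) (a h : F) (d : nat) :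
  (size q <= d.+2)%N -> h != 0 -> root q a -> root q (a + h) ->
  q^`().[a] = - h * \sum_(i < d) q^`N(i.+2).[a] * h ^+ i.
Proof.
move=> sq h0 /eqP qa /eqP.
rewrite (nderiv_taylor_wide (mulrC _ _) sq) 2!big_ord_recl nderivn0 qa mul0r add0r.
rewrite /= nderivn1 expr1 mulNr => /eqP; rewrite addr_eq0 => /eqP dE.
apply: (mulIf h0); rewrite dE mulNr; congr (- _).
rewrite mulrAC -expr2 mulr_sumr; apply: eq_bigr => i _.
by rewrite [RHS]mulrCA -exprD add2n.
Qed.

(** * Entrywise and coefficientwise convergence *)

Lemma cvg_sumr (K : numFieldType) (T I : Type) (F : set_system T) (FF : Filter F)
    (r : seq I) (P : pred I) (f : I -> T -> K) (a : I -> K) :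
  (forall i, f i t @[t --> F] --> a i) ->
  (\sum_(i <- r | P i) f i t) @[t --> F] --> \sum_(i <- r | P i) a i.
Proof. by move=> fa; apply: cvg_big => // -[u v]; exact: add_continuous. Qed.

Lemma cvg_prodr (K : numFieldType) (T I : Type) (F : set_system T) (FF : Filter F)
    (r : seq I) (P : pred I) (f : I -> T -> K) (a : I -> K) :
  (forall i, f i t @[t --> F] --> a i) ->
  (\prod_(i <- r | P i) f i t) @[t --> F] --> \prod_(i <- r | P i) a i.
Proof. by move=> fa; apply: cvg_big => // -[u v]; exact: mul_continuous. Qed.

(** Convergence of the entries.  It is the form needed for complex matrices,
    where every limit reduces to sums and products of entries; [mxcvgP] links it
    to the norm topology. *)
Definition mxcvg (K : numFieldType) (T : Type) (F : set_system T) (m n : nat)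
    (A : T -> 'M[K]_(m, n)) (B : 'M[K]_(m, n)) : Prop :=
  forall i j, A t i j @[t --> F] --> B i j.

Lemma mxcvg_cst (K : numFieldType) (T : Type) (F : set_system T) (FF : Filter F)
  (m n : nat) (B : 'M[K]_(m, n)) : mxcvg F (fun=> B) B.
Proof. by move=> i j; exact: cvg_cst. Qed.

Lemma mxcvgB (K : numFieldType) (T : Type) (F : set_system T) (FF : Filter F)
    (m n : nat) (A A' : T -> 'M[K]_(m, n)) (B B' : 'M[K]_(m, n)) :
  mxcvg F A B -> mxcvg F A' B' -> mxcvg F (fun t => A t - A' t) (B - B').
Proof.
move=> AB AB' i j; rewrite !mxE.
by under eq_fun do rewrite !mxE; apply: cvgB; [exact: AB|exact: AB'].
Qed.

Lemma mxcvg_scalar (K : numFieldType) (T : Type) (F : set_system T) (FF : Filter F)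
    (n : nat) (u : T -> K) (a : K) :
  u t @[t --> F] --> a -> mxcvg F (fun t => (u t)%:M : 'M[K]_n) (a%:M).
Proof.
move=> ua i j; rewrite mxE; under eq_fun do rewrite mxE.
by case: (i == j); [exact: ua|exact: cvg_cst].
Qed.

Lemma mxcvgM (K : numFieldType) (T : Type) (F : set_system T) (FF : Filter F)
    (m n p : nat) (A : T -> 'M[K]_(m, n)) (A' : T -> 'M[K]_(n, p)) B B' :
  mxcvg F A B -> mxcvg F A' B' -> mxcvg F (fun t => A t *m A' t) (B *m B').
Proof.
move=> AB AB' i j; rewrite mxE; under eq_fun do rewrite mxE.
by apply: cvg_sumr => k; apply: cvgM; [exact: AB|exact: AB'].
Qed.

Lemma sub_mxcvg (K : numFieldType) (T : Type) (F G : set_system T) (m n : nat)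
    (A : T -> 'M[K]_(m, n)) (B : 'M[K]_(m, n)) :
  F `=>` G -> mxcvg G A B -> mxcvg F A B.
Proof. by move=> FG AB i j s /(AB i j); exact: FG. Qed.

Lemma mxcvgP (K : numFieldType) (T : Type) (F : set_system T) (FF : Filter F)
    (m n : nat) (A : T -> 'M[K]_(m, n)) (B : 'M[K]_(m, n)) :
  mxcvg F A B <-> A t @[t --> F] --> B.
Proof.
split=> [AB s [P Pn Ps]|AB i j]; last first.
  exact: (cvg_comp _ _ AB (@coord_continuous K m n i j B)).
have : \forall t \near F, forall i j, P i j (A t i j).
  by apply: filter_forall => i; apply: filter_forall => j; apply: AB; exact: Pn.
by apply: filterS => t At; apply: Ps.
Qed.

Lemma cvg_det (K : numFieldType) (T : Type) (F : set_system T) (FF : Filter F)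
    (n : nat) (A : T -> 'M[K]_n) (B : 'M[K]_n) :
  mxcvg F A B -> \det (A t) @[t --> F] --> \det B.
Proof.
move=> AB; apply: cvg_sumr => s; apply: cvgM; first exact: cvg_cst.
by apply: cvg_prodr => i; exact: AB.
Qed.

Lemma mxcvg_adj (K : numFieldType) (T : Type) (F : set_system T) (FF : Filter F)
    (n : nat) (A : T -> 'M[K]_n) (B : 'M[K]_n) :
  mxcvg F A B -> mxcvg F (fun t => \adj (A t)) (\adj B).
Proof.
move=> AB i j; rewrite mxE; under eq_fun do rewrite mxE.
apply: cvgM; first exact: cvg_cst.
by apply: cvg_det => a b; rewrite !mxE; under eq_fun do rewrite !mxE; exact: AB.
Qed.

Definition polycvg (K : numFieldType) (T : Type) (F : set_system T)
    (p : T -> {poly K}) (q : {poly K}) : Prop :=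
  forall i, (p t)`_i @[t --> F] --> q`_i.

Lemma polycvg_char_poly (K : numFieldType) (T : Type) (F : set_system T)
    (FF : Filter F) (n : nat) (A : T -> 'M[K]_n) (B : 'M[K]_n) :
  mxcvg F A B -> polycvg F (fun t => char_poly (A t)) (char_poly B).
Proof.
have cM (p p' : T -> {poly K}) q q' : polycvg F p q -> polycvg F p' q' ->
    polycvg F (fun t => p t * p' t) (q * q').
  move=> pq pq' i; rewrite coefM; under eq_fun do rewrite coefM.
  by apply: cvg_sumr => j; apply: cvgM; [exact: pq|exact: pq'].
have cP (I : finType) (p : I -> T -> {poly K}) q :
    (forall i, polycvg F (p i) (q i)) ->
    polycvg F (fun t => \prod_(i : I) p i t) (\prod_(i : I) q i).
  move=> pq; elim: (index_enum I) => [|i s IH].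
    by rewrite big_nil; under eq_fun do rewrite big_nil; move=> i; exact: cvg_cst.
  by rewrite big_cons; under eq_fun do rewrite big_cons; exact: cM.
move=> AB; rewrite /char_poly => i; rewrite coef_sum.
under eq_fun do rewrite coef_sum.
apply: cvg_sumr => s; apply: (cM (fun=> _)); first by move=> k; exact: cvg_cst.
apply: cP => k j; rewrite !mxE !coefB coefC; under eq_fun do rewrite !mxE !coefB coefC.
apply: cvgB; first exact: cvg_cst.
by case: (j == 0)%N; [exact: AB|exact: cvg_cst].
Qed.

Lemma polycvg_nderivn (K : numFieldType) (T : Type) (F : set_system T)
    (FF : Filter F) (p : T -> {poly K}) (q : {poly K}) (j : nat) :
  polycvg F p q -> polycvg F (fun t => (p t)^`N(j)) q^`N(j).
Proof.
move=> pq i; rewrite coef_nderivn -mulr_natr.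
under eq_fun do rewrite coef_nderivn -mulr_natr.
by apply: cvgM; [exact: pq|exact: cvg_cst].
Qed.

Lemma cvg_exprn (K : numFieldType) (T : Type) (F : set_system T) (FF : Filter F)
    (u : T -> K) (a : K) (e : nat) :
  u t @[t --> F] --> a -> u t ^+ e @[t --> F] --> a ^+ e.
Proof.
move=> ua; elim: e => [|e IH]; first by under eq_fun do rewrite expr0; exact: cvg_cst.
by rewrite exprS; under eq_fun do rewrite exprS; exact: cvgM.
Qed.

Lemma cvg_horner (K : numFieldType) (T : Type) (F : set_system T) (FF : Filter F)
    (d : nat) (p : T -> {poly K}) (q : {poly K}) (u : T -> K) (a : K) :
  (forall t, (size (p t) <= d)%N) -> (size q <= d)%N -> polycvg F p q ->
  u t @[t --> F] --> a -> (p t).[u t] @[t --> F] --> q.[a].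
Proof.
move=> sp sq pq ua; rewrite (horner_coef_wide _ sq).
under eq_fun do rewrite (horner_coef_wide _ (sp _)).
apply: cvg_sumr => i; apply: cvgM; first exact: pq.
exact: cvg_exprn.
Qed.

(** * Roots and eigenvalues depending on a parameter *)

(** The complex numbers as an abstract field structure, which is what carries
    the topology defined by the norm. *)
Definition Cx (R : realType) : numClosedFieldType := R[i].

Lemma cvg_complex (R : realType) (T : Type) (F : set_system T) (FF : Filter F)
    (u : T -> R[i]) (l : R[i]) :
  complex.Re (u t) @[t --> F] --> complex.Re l ->
  complex.Im (u t) @[t --> F] --> complex.Im l ->
  (u : T -> Cx R) t @[t --> F] --> (l : Cx R).
Proof.
move=> ur ui; apply/cvgrPdist_lt => -[e e'] /=; rewrite ltcE /= => /andP[/eqP -> e0].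
have e20 : 0 < e / 2 by rewrite divr_gt0.
move/cvgrPdist_lt: ur => /(_ _ e20) ur; move/cvgrPdist_lt: ui => /(_ _ e20) ui.
near=> t.
have h1 : `|complex.Re l - complex.Re (u t)| < e / 2 by near: t.
have h2 : `|complex.Im l - complex.Im (u t)| < e / 2 by near: t.
rewrite normc_def ltcR.
have -> : complex.Re (l - u t) = complex.Re l - complex.Re (u t).
  by case: (l) (u t) => [? ?] [? ?].
have -> : complex.Im (l - u t) = complex.Im l - complex.Im (u t).
  by case: (l) (u t) => [? ?] [? ?].
rewrite -[X in _ < X](ger0_norm (ltW e0)) -sqrtr_sqr ltr_sqrt ?exprn_gt0 //.
rewrite -(real_normK (num_real (complex.Re l - _))).
rewrite -(real_normK (num_real (complex.Im l - _))).
have k1 : `|complex.Re l - complex.Re (u t)| ^+ 2 < (e / 2) ^+ 2.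
  by rewrite ltrXn2r // ?nnegrE // ltW.
have k2 : `|complex.Im l - complex.Im (u t)| ^+ 2 < (e / 2) ^+ 2.
  by rewrite ltrXn2r // ?nnegrE // ltW.
nra.
Unshelve. all: by end_near. Qed.

Lemma cvg_Re (R : realType) (T : Type) (F : set_system T) (FF : Filter F)
    (u : T -> Cx R) (l : Cx R) :
  u t @[t --> F] --> l -> complex.Re (u t) @[t --> F] --> complex.Re l.
Proof.
move=> ul; apply/cvgrPdist_lt => e e0.
have e0' : (0 : Cx R) < e%:C%C by rewrite (ltcR 0 e).
move/cvgrPdist_lt: ul => /(_ _ e0'); apply: filterS => t h.
rewrite -ltcR; apply: le_lt_trans h.
have -> : complex.Re l - complex.Re (u t) = complex.Re (l - u t).
  by case: (l) (u t) => [? ?] [? ?].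
exact: normc_ge_Re.
Qed.

Lemma mxcvg_complex (R : realType) (T : Type) (F : set_system T) (FF : Filter F)
    (m n : nat) (A : T -> 'M[R]_(m, n)) (B : 'M[R]_(m, n)) :
  mxcvg F A B ->
  mxcvg F (fun t => map_mx (real_complex R) (A t) : 'M[Cx R]_(m, n))
          (map_mx (real_complex R) B).
Proof.
move=> AB i j; rewrite mxE; under eq_fun do rewrite mxE.
by apply: cvg_complex => /=; [exact: AB|exact: cvg_cst].
Qed.

(** Cauchy's bound: if |z| > 1, divide the equation by the power of z just below
    the leading one, which bounds every lower power. *)
Lemma monic_root_bound (K : numFieldType) (d : nat) (p : {poly K}) (z : K) :
  p \is monic -> (size p <= d.+1)%N -> root p z ->
  `|z| <= 1 + \sum_(i < d) `|p`_i|.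
Proof.
move=> pm; set s := size p; move: (erefl s); rewrite {1}/s.
case: s => [|[|s]] sp sd pz.
- move/eqP: sp pm; rewrite size_poly_eq0 => /eqP ->.
  by rewrite monicE lead_coef0 eq_sym oner_eq0.
- move/eqP: sp pz => /size_poly1P [c c0 ->].
  by rewrite rootC (negPf c0).
have [h|h] := real_leP (normr_real z) (real1 _).
  by rewrite (le_trans h) // lerDl sumr_ge0.
have z0 : 0 < `|z| by apply: lt_trans h.
rewrite (@le_trans _ _ (\sum_(i < s.+1) `|p`_i|)) //; last first.
  rewrite (@le_trans _ _ (\sum_(i < d) `|p`_i|)) ?lerDr //.
  rewrite (big_ord_widen d (fun i => `|p`_i|)) // big_mkcond ler_sum // => i _.
  by case: ifP.
rewrite -(ler_pM2r (exprn_gt0 s z0)) -exprS -normrX.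
have : p.[z] = 0 by apply/eqP.
rewrite horner_coef sp big_ord_recr /=.
have -> : p`_s.+1 = 1 by have := monicP pm; rewrite lead_coefE sp.
rewrite mul1r => /eqP; rewrite addrC addr_eq0 => /eqP ->; rewrite normrN.
apply: le_trans (ler_norm_sum _ _ _) _; rewrite mulr_suml ler_sum // => i _.
rewrite normrM ler_wpM2l // normrX ler_weXn2l // ?ltW //.
by rewrite -ltnS ltn_ord.
Qed.

(** Factor q over its roots: a root outside the strip
    0 <= Re <= c, 0 <= Im is at a positive distance from it, because it violates
    one of the three closed inequalities. *)
Lemma poly_norm_lower_strip (R : realType) (c : R) (q : {poly R[i]}) :
  q != 0 ->
  (forall z, root q z -> 0 <= complex.Re z -> complex.Re z <= c ->
     0 <= complex.Im z -> False) ->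
  exists2 d : R, 0 < d & forall z, 0 <= complex.Re z -> complex.Re z <= c ->
     0 <= complex.Im z -> d%:C%C <= `|q.[z]|.
Proof.
move=> q0 qr; have [s sE] := closed_field_poly_normal q.
have {}qr z : z \in s -> 0 <= complex.Re z -> complex.Re z <= c ->
    0 <= complex.Im z -> False.
  by move=> zs; apply: qr; rewrite sE rootZ ?lead_coef_eq0 // root_prod_XsubC.
have [d d0 dP] : exists2 d : R, 0 < d & forall z, 0 <= complex.Re z ->
    complex.Re z <= c -> 0 <= complex.Im z ->
    d%:C%C <= `|(\prod_(w <- s) ('X - w%:P)).[z]|.
  elim: s qr {sE} => [|w s IH] qr.
    by exists 1 => // z _ _ _; rewrite big_nil hornerC normr1.
  have [d d0 dP] := IH (fun z zs => qr z (mem_behead (s := w :: s) zs)).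
  suff [d' d'0 d'P] : exists2 d' : R, 0 < d' & forall z, 0 <= complex.Re z ->
      complex.Re z <= c -> 0 <= complex.Im z -> d'%:C%C <= `|z - w|.
    exists (d' * d); first exact: mulr_gt0.
    move=> z z1 z2 z3; rewrite big_cons hornerM hornerXsubC normrM rmorphM /=.
    by rewrite ler_pM ?d'P ?dP // lecR ltW.
  have {qr} := qr w (mem_head _ _); case: w => a b /= qr.
  have [a0|a0] := ltP a 0.
    exists (- a); first by rewrite oppr_gt0.
    move=> [z1 z2] /= z10 _ _; apply: le_trans (normc_ge_Re _).
    by rewrite lecR /= (le_trans _ (ler_norm _)) // lerDr.
  have [ac|ac] := ltP c a.
    exists (a - c); first by rewrite subr_gt0.
    move=> [z1 z2] /= _ z1c _; apply: le_trans (normc_ge_Re _).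
    by rewrite lecR /= distrC (le_trans _ (ler_norm _)) // lerD2l lerN2.
  have [b0|b0] := ltP b 0; last by case: (qr a0 ac b0).
  exists (- b); first by rewrite oppr_gt0.
  move=> [z1 z2] /= _ _ z20; rewrite normc_def lecR /=.
  apply: (@le_trans _ _ (Num.sqrt ((z2 - b) ^+ 2))); last first.
    by rewrite ler_wsqrtr // lerDr sqr_ge0.
  by rewrite sqrtr_sqr (le_trans _ (ler_norm _)) // lerDr.
have l0 : 0 < `|lead_coef q| by rewrite normr_gt0 lead_coef_eq0.
have lE : `|lead_coef q| = (complex.Re `|lead_coef q|)%:C%C by rewrite normc_def.
exists (complex.Re `|lead_coef q| * d).
  by rewrite mulr_gt0 // -ltcR -lE.
move=> z z1 z2 z3; rewrite [in X in _ <= X]sE hornerZ normrM rmorphM /= -lE.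
by rewrite ler_wpM2l // dP.
Qed.

(** Write char_poly N0 = ('X - l) g.  On the strip |g| is bounded below, so
    |mu_t - l| is controlled by the value of char_poly N0 at mu_t; as mu_t is a
    root of char_poly (N t), that value is a combination of differences of
    coefficients with bounded powers of mu_t, and tends to 0. *)
Lemma cvg_root_in_strip (R : realType) (T : Type) (F : set_system T) (FF : Filter F)
    (n : nat) (c : R) (N : T -> 'M[Cx R]_n) (N0 : 'M[Cx R]_n)
    (mu : T -> Cx R) (l : Cx R) :
  mxcvg F N N0 ->
  (\forall t \near F, [/\ root (char_poly (N t)) (mu t),
     0 <= complex.Re (mu t), complex.Re (mu t) <= c & 0 <= complex.Im (mu t)]) ->
  mup l (char_poly N0) = 1%N ->
  (forall z : R[i], root (char_poly N0) z -> 0 <= complex.Re z ->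
     complex.Re z <= c -> 0 <= complex.Im z -> z = l) ->
  mu t @[t --> F] --> l.
Proof.
move=> NN0 near_mu m1 uniq_l.
have P0 : char_poly N0 != 0 by rewrite monic_neq0 // char_poly_monic.
have /dvdpP [g gE] : 'X - l%:P %| char_poly N0 by rewrite XsubC_dvd // m1.
have g0 : g != 0 by apply: contraNneq P0; rewrite gE => ->; rewrite mul0r.
have gl : ~~ root g l.
  have := nderivn_mup l P0; rewrite m1 nderivn1 gE derivM derivXsubC hornerD !hornerM.
  by rewrite hornerXsubC subrr mulr0 add0r hornerC mulr1.
have [d d0 dP] : exists2 d : R, 0 < d & forall z, 0 <= complex.Re z ->
    complex.Re z <= c -> 0 <= complex.Im z -> d%:C%C <= `|g.[z]|.
  apply: poly_norm_lower_strip => // z gz z1 z2 z3; move: gl; rewrite -(uniq_l z) ?gz //.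
  by rewrite gE rootM gz.
have dC : (0 : Cx R) < d%:C%C by rewrite (ltcR 0 d).
have pc := polycvg_char_poly FF NN0.
(* The bound on |mu t| from [monic_root_bound] varies with t but converges,
   so no uniform bound is needed. *)
pose b t : Cx R := 1 + \sum_(i < n) `|(char_poly (N t))`_i|.
pose r t : Cx R := \sum_(i < n.+1) `|(char_poly N0)`_i - (char_poly (N t))`_i| * b t ^+ i.
have r0 : r t @[t --> F] --> (0 : Cx R).
  have -> : (0 : Cx R) = \sum_(i < n.+1) `|(char_poly N0)`_i - (char_poly N0)`_i|
      * (1 + \sum_(i < n) `|(char_poly N0)`_i|) ^+ i.
    by rewrite big1 // => i _; rewrite subrr normr0 mul0r.
  apply: cvg_sumr => i; apply: cvgM.
    by apply: cvg_norm; apply: cvgB; [exact: cvg_cst|exact: pc].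
  apply: cvg_exprn; apply: cvgD; first exact: cvg_cst.
  by apply: cvg_sumr => j; apply: cvg_norm; exact: pc.
apply/cvgrPdist_lt => e e0; move/cvgrPdist_lt: r0 => /(_ _ (mulr_gt0 dC e0)) r0.
near=> t.
have [mr m0 mc mi] : [/\ root (char_poly (N t)) (mu t),
     0 <= complex.Re (mu t), complex.Re (mu t) <= c & 0 <= complex.Im (mu t)].
  by near: t.
have rt : `|0 - r t| < d%:C%C * e by near: t.
rewrite -(ltr_pM2l dC); apply: le_lt_trans rt.
rewrite sub0r normrN distrC (le_trans (ler_wpM2r _ (dP _ m0 mc mi))) //.
rewrite -normrM -hornerXsubC -hornerM -gE.
have -> : (char_poly N0).[mu t] = (char_poly N0 - char_poly (N t)).[mu t].
  by rewrite hornerD hornerN (eqP mr) subr0.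
have sz : (size (char_poly N0 - char_poly (N t))%R <= n.+1)%N.
  by apply: leq_trans (size_polyD _ _) _; rewrite size_polyN !size_char_poly maxnn.
have b0 : 0 <= b t by rewrite addr_ge0 // sumr_ge0.
have mb : `|mu t| <= b t.
  by apply: monic_root_bound => //; rewrite ?char_poly_monic ?size_char_poly.
rewrite (horner_coef_wide _ sz) (le_trans (ler_norm_sum _ _ _)) // ger0_norm; last first.
  by rewrite sumr_ge0 // => i _; rewrite mulr_ge0 // exprn_ge0.
apply: ler_sum => i _; rewrite normrM normrX coefB ler_wpM2l //.
by rewrite lerXn2r ?nnegrE.
Unshelve. all: by end_near. Qed.

(** The vector v t = adj (mu t - N t) y is annihilated by mu t - N t and tends
    to a nonzero multiple of y.  Hence (mu t - l) (x v) = x (N t - N0) v, an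
    exact identity in which every factor has a limit.  The scaling s t is 1 / t
    in the applications. *)
Lemma eigenvalue_difference_quotient (K : numFieldType) (T : Type) (F : set_system T)
    (FF : Filter F) (n : nat) (N : T -> 'M[K]_n) (N0 N' : 'M[K]_n) (mu s : T -> K)
    (l : K) (x : 'rV[K]_n) (y : 'cV[K]_n) :
  mxcvg F N N0 -> mxcvg F (fun t => s t *: (N t - N0)) N' ->
  mu t @[t --> F] --> l ->
  (\forall t \near F, root (char_poly (N t)) (mu t)) ->
  x *m N0 = l *: x -> N0 *m y = l *: y ->
  (char_poly N0)^`().[l] != 0 -> (x *m y) 0 0 != 0 ->
  s t * (mu t - l) @[t --> F] --> (x *m N' *m y) 0 0 / (x *m y) 0 0.
Proof.
move=> NN0 sN mul nr xN Ny c0 xy0.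
pose v t := \adj ((mu t)%:M - N t) *m y.
have vc : mxcvg F v ((char_poly N0)^`().[l] *: y).
  rewrite -(adj_eigenvector Ny); apply: mxcvgM; last exact: mxcvg_cst.
  by apply: mxcvg_adj; apply: mxcvgB => //; exact: mxcvg_scalar.
have xvc : (x *m v t) 0 0 @[t --> F] --> (char_poly N0)^`().[l] * (x *m y) 0 0.
  have := mxcvgM FF (@mxcvg_cst _ _ _ FF _ _ x) vc.
  by move=> /(_ 0 0); rewrite -scalemxAr mxE.
have -> : (x *m N' *m y) 0 0 / (x *m y) 0 0 =
    (x *m N' *m ((char_poly N0)^`().[l] *: y)) 0 0 /
    ((char_poly N0)^`().[l] * (x *m y) 0 0).
  have -> : (x *m N' *m ((char_poly N0)^`().[l] *: y)) 0 0 =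
      (char_poly N0)^`().[l] * (x *m N' *m y) 0 0 by rewrite -scalemxAr mxE.
  by rewrite invfM mulrACA divff // mul1r.
have : (x *m (s t *: (N t - N0)) *m v t) 0 0 / (x *m v t) 0 0 @[t --> F] -->
    (x *m N' *m ((char_poly N0)^`().[l] *: y)) 0 0 /
    ((char_poly N0)^`().[l] * (x *m y) 0 0).
  apply: cvgM; last by apply: cvgV => //; rewrite mulf_neq0.
  exact: (mxcvgM FF (mxcvgM FF (@mxcvg_cst _ _ _ FF _ _ x) sN) vc).
apply: cvg_trans; apply: near_eq_cvg; near=> t.
have rt : root (char_poly (N t)) (mu t) by near: t.
have xv0 : (x *m v t) 0 0 != 0.
  near: t.
  have k0 : (char_poly N0)^`().[l] * (x *m y) 0 0 != 0 by rewrite mulf_neq0.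
  exact: (cvgr_neq0 _ xvc k0).
have Nv : N t *m v t = mu t *: v t.
  apply/eqP; rewrite eq_sym -subr_eq0 -mul_scalar_mx -mulmxBl /v mulmxA mul_mx_adj.
  move/eqP: rt; rewrite /char_poly -horner_evalE -det_map_mx.
  have -> : map_mx (horner_eval (mu t)) (char_poly_mx (N t)) = (mu t)%:M - N t.
    rewrite map_mxB map_scalar_mx /= /horner_eval hornerX; congr (_ - _).
    by apply/matrixP => i j; rewrite !mxE /horner_eval hornerC.
  by move=> ->; rewrite mul_scalar_mx scale0r.
have xNv : x *m (N t - N0) *m v t = (mu t - l) *: (x *m v t).
  by rewrite mulmxBr mulmxBl -mulmxA Nv xN -scalemxAl -scalemxAr scalerBl.
apply: (mulIf xv0); rewrite divfK // -scalemxAr -scalemxAl xNv scalerA.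
by rewrite [in LHS]mxE.
Unshelve. all: by end_near. Qed.

(** * Overlap of the left and right eigenvectors near a defective double eigenvalue *)

(** With adj (l - N) = a x^*, applying both sides to y identifies a (x^* y) with
    chi'(l) y; then take norms, x and y being unit vectors. *)
Lemma adj_norm_overlap (K : numClosedFieldType) (n : nat) (N : 'M[K]_n) (l : K)
    (x y : 'cV[K]_n) :
  x ^t* *m N = l *: x ^t* -> N *m y = l *: y ->
  \sum_i `|x i 0| ^+ 2 = 1 -> \sum_i `|y i 0| ^+ 2 = 1 ->
  (char_poly N)^`().[l] != 0 ->
  (\sum_i \sum_j `|\adj (l%:M - N) i j| ^+ 2) * `|(x ^t* *m y) 0 0| ^+ 2 =
  `|(char_poly N)^`().[l]| ^+ 2.
Proof.
move=> xN Ny nx ny c0.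
have y0 : y != 0.
  apply/eqP => y0; move: ny; rewrite y0 big1 => [/esym/eqP|i _].
    by rewrite oner_eq0.
  by rewrite mxE normr0 expr0n.
have x0 : x ^t* != 0.
  apply/eqP => x0; move: nx; rewrite big1 => [/esym/eqP|i _].
    by rewrite oner_eq0.
  have /matrixP /(_ 0 i) := x0; rewrite !mxE => /eqP.
  by rewrite conjC_eq0 => /eqP ->; rewrite normr0 expr0n.
have aW := adj_eigenvector Ny.
have xW : x ^t* *m (l%:M - N) = 0 by rewrite mulmxBr xN mul_mx_scalar subrr.
have rW : \rank (l%:M - N) = n.-1.
  apply/eqP; rewrite eqn_leq; apply/andP; split; last first.
    rewrite leqNgt; apply/negP => /adj_eq0_rank a0; move: aW; rewrite a0 mul0mx.
    by move/esym/eqP; rewrite scaler_eq0 (negPf c0) (negPf y0).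
  have : ~~ row_free (l%:M - N).
    by apply: contraNN x0 => f; apply/eqP; apply: (row_free_inj f); rewrite xW mul0mx.
  rewrite /row_free => nf; have lt_n : (\rank (l%:M - N)%R < n)%N.
    by rewrite ltn_neqAle nf rank_leq_row.
  by rewrite -ltnS prednK // (leq_ltn_trans _ lt_n).
have [a aE] := adj_rank1 rW x0 xW.
have ay i : a i 0 * (x ^t* *m y) 0 0 = (char_poly N)^`().[l] * y i 0.
  move: aW; rewrite aE -mulmxA => /matrixP /(_ i 0); rewrite mxE big_ord1 => ->.
  by rewrite mxE.
have -> : \sum_i \sum_j `|\adj (l%:M - N) i j| ^+ 2 = \sum_i `|a i 0| ^+ 2.
  apply: eq_bigr => i _; rewrite -[RHS]mulr1 -nx mulr_sumr.
  apply: eq_bigr => j _.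
  by rewrite aE mxE big_ord1 !mxE normrM norm_conjC exprMn.
rewrite mulr_suml.
under eq_bigr do rewrite -exprMn -normrM ay normrM exprMn.
by rewrite -mulr_sumr ny mulr1.
Qed.

Lemma cvg_div_norm_sqr (K : numFieldType) (T : Type) (F : set_system T)
    (FF : Filter F) (A r : T -> K) (A0 r0 : K) :
  A t @[t --> F] --> A0 -> r t @[t --> F] --> r0 -> r0 != 0 ->
  A t / (4%:R * `|r t| ^+ 2) @[t --> F] --> A0 / (4%:R * `|r0| ^+ 2).
Proof.
move=> AA0 rr0 r00; apply: cvgM; first exact: AA0.
apply: cvgV; first by rewrite mulf_neq0 ?pnatr_eq0 // expf_neq0 // normr_eq0.
by apply: cvgM; [exact: cvg_cst|apply: cvg_exprn; exact: cvg_norm].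
Qed.

(** By [adj_norm_overlap], (x^* y)^2 is |chi'(l)|^2 divided by the squared norm
    of the adjugate.  The two roots l and - conj l merge, which gives
    chi'(l) = 2 Re l * r with r tending to chi''(l0) / 2; so Re l is proportional
    to x^* y in the limit, with the square of the factor being
    |adj|^2 / (4 |r|^2). *)
Lemma overlap_asymptotics (R : realType) (T : Type) (F : set_system T)
    (FF : ProperFilter F) (n : nat) (N : T -> 'M[Cx R]_n) (N0 : 'M[Cx R]_n)
    (l : T -> Cx R) (l0 : Cx R) (x y : T -> 'cV[Cx R]_n) :
  mxcvg F N N0 -> l t @[t --> F] --> l0 ->
  complex.Re l0 = 0 -> mup l0 (char_poly N0) = 2%N ->
  (\rank (eigenspace N0 l0) < 2)%N ->
  (\forall t \near F, [/\ 0 < complex.Re (l t),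
     mup (l t) (char_poly (N t)) = 1%N &
     root (char_poly (N t)) (- (conjc (l t) : Cx R))]) ->
  (\forall t \near F, [/\ (x t) ^t* *m N t = l t *: (x t) ^t*, N t *m y t = l t *: y t,
     \sum_i `|x t i 0| ^+ 2 = 1, \sum_i `|y t i 0| ^+ 2 = 1 &
     0 < ((x t) ^t* *m y t) 0 0]) ->
  exists2 Q : T -> R, exists2 q : R, 0 < q & Q t @[t --> F] --> q &
    \forall t \near F, complex.Re (l t) ^+ 2 =
      complex.Re (((x t) ^t* *m y t) 0 0) ^+ 2 * Q t.
Proof.
move=> NN0 ll0 rl0 m2 g2 nl nxy.
have cN0 : char_poly N0 != 0 by rewrite monic_neq0 // char_poly_monic.
have rt0 : root (char_poly N0) l0 by rewrite -dvdp_XsubCl XsubC_dvd // m2.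
have n0 : (0 < n)%N.
  rewrite lt0n; apply/eqP => nE.
  have : size (char_poly N0) = 1%N by rewrite size_char_poly nE.
  by move=> /eqP /size_poly1P [c c0 cE]; move: rt0; rewrite cE rootC (negPf c0).
(* The step from l to the mirrored root - conj l; it is real. *)
pose h t : Cx R := - ((conjc (l t) : Cx R) + l t).
have hE t : h t = (- (2 * complex.Re (l t)))%:C%C.
  rewrite /h; case: (l t) => a b; rewrite /=; apply/eqP; rewrite eq_complex /=.
  by rewrite mulr_natl mulr2n addNr oppr0 !eqxx.
have h0 : h t @[t --> F] --> (0 : Cx R).
  under eq_fun do rewrite hE.
  apply: cvg_complex => /=; last exact: cvg_cst.
  have -> : 0 = - (2 * complex.Re l0) by rewrite rl0 mulr0 oppr0.
  by apply: cvgN; apply: cvgM; [exact: cvg_cst|exact: cvg_Re].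
pose r t : Cx R := \sum_(i < n) (char_poly (N t))^`N(i.+2).[l t] * h t ^+ i.
pose r0 : Cx R := (char_poly N0)^`N(2).[l0].
have r00 : r0 != 0 by rewrite /r0 -m2; exact: nderivn_mup.
have pc := polycvg_char_poly FF NN0.
have sz d (q : {poly Cx R}) : (size q <= n.+1)%N -> (size q^`N(d) <= n.+1)%N.
  by move=> sq; apply/leq_sizeP => j nj; rewrite coef_nderivn nth_default ?mul0rn //
     (leq_trans sq) // (leq_trans nj) // leq_addl.
have rr0 : r t @[t --> F] --> r0.
  have -> : r0 = \sum_(i < n) (char_poly N0)^`N(i.+2).[l0] * (0 : Cx R) ^+ i.
    case: (n) n0 (char_poly N0) @r0 {r00} => // n' _ q r0.
    rewrite big_ord_recl expr0 mulr1 big1 ?addr0 // => i _.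
    by rewrite exprS mul0r mulr0.
  apply: cvg_sumr => i; apply: cvgM; last exact: cvg_exprn.
  have s1 t : (size (char_poly (N t))^`N(i.+2) <= n.+1)%N.
    by apply: sz; rewrite size_char_poly.
  have s2 : (size (char_poly N0)^`N(i.+2) <= n.+1)%N.
    by apply: sz; rewrite size_char_poly.
  exact: (@cvg_horner (Cx R) T F _ n.+1 _ _ _ _ s1 s2 (polycvg_nderivn _ pc) ll0).
pose A t : Cx R := \sum_i \sum_j `|\adj ((l t)%:M - N t) i j| ^+ 2.
pose A0 : Cx R := \sum_i \sum_j `|\adj (l0%:M - N0) i j| ^+ 2.
have AA0 : A t @[t --> F] --> A0.
  have aN := mxcvg_adj FF (mxcvgB FF (mxcvg_scalar FF ll0) NN0).
  apply: cvg_sumr => i; apply: cvg_sumr => j; apply: cvg_exprn; apply: cvg_norm.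
  exact: aN.
have A_ge0 t : 0 <= A t.
  by apply: sumr_ge0 => i _; apply: sumr_ge0 => j _; rewrite exprn_ge0.
have A00 : 0 < A0.
  have : \adj (l0%:M - N0) != 0.
    apply: adj_neq0 => //.
      have : (\rank (eigenspace N0 l0) < 2)%N by [].
      rewrite /eigenspace mxrank_ker -opprB mxrank_opp.
      by rewrite ltnS leq_subLR addn1 -subn1 leq_subLR add1n.
    have -> : l0%:M - N0 = - (N0 - l0%:M) by rewrite opprB.
    rewrite -scaleN1r detZ; have : eigenvalue N0 l0 by rewrite eigenvalue_root_char.
    rewrite /eigenvalue /eigenspace kermx_eq0 row_free_unit unitmxE unitfE negbK => /eqP ->.
    by rewrite mulr0.
  move/eqP => aN; rewrite lt_neqAle eq_sym; apply/andP; split; last first.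
    by apply: sumr_ge0 => i _; apply: sumr_ge0 => j _; rewrite exprn_ge0.
  apply/negP => /eqP A0E; apply: aN; apply/matrixP => i j; rewrite [RHS]mxE.
  move/eqP: A0E; rewrite psumr_eq0 => [/allP /(_ i (mem_index_enum _))|k _]; last first.
    by apply: sumr_ge0 => ? _; rewrite exprn_ge0.
  rewrite /= psumr_eq0 => [/allP /(_ j (mem_index_enum _))|k _]; last by rewrite exprn_ge0.
  by rewrite /= expf_eq0 /= normr_eq0 => /eqP.
have qc : A t / (4%:R * `|r t| ^+ 2) @[t --> F] --> A0 / (4%:R * `|r0| ^+ 2).
  exact: (cvg_div_norm_sqr FF AA0 rr0 r00).
exists (fun t => complex.Re (A t / (4%:R * `|r t| ^+ 2))).
  exists (complex.Re (A0 / (4%:R * `|r0| ^+ 2))); last exact: cvg_Re.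
  have : 0 < A0 / (4%:R * `|r0| ^+ 2).
    by rewrite divr_gt0 // mulr_gt0 ?ltr0n // exprn_gt0 // normr_gt0.
  by rewrite ltcE => /andP[].
near=> t.
have [l_gt0 m1 rtc] : [/\ 0 < complex.Re (l t),
   mup (l t) (char_poly (N t)) = 1%N &
   root (char_poly (N t)) (- (conjc (l t) : Cx R))] by near: t.
have [xN Ny nx ny xy0] : [/\ (x t) ^t* *m N t = l t *: (x t) ^t*, N t *m y t = l t *: y t,
     \sum_i `|x t i 0| ^+ 2 = 1, \sum_i `|y t i 0| ^+ 2 = 1 &
     0 < ((x t) ^t* *m y t) 0 0] by near: t.
have rt_neq0 : r t != 0 by near: t; exact: (cvgr_neq0 _ rr0 r00).
have cNt : char_poly (N t) != 0 by rewrite monic_neq0 // char_poly_monic.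
have c0 : (char_poly (N t))^`().[l t] != 0.
  by have := nderivn_mup (l t) cNt; rewrite m1 nderivn1.
have := adj_norm_overlap xN Ny nx ny c0.
have -> : (char_poly (N t))^`().[l t] = - h t * r t.
  apply: deriv_two_roots.
  - by rewrite size_char_poly.
  - by rewrite hE fmorph_eq0 oppr_eq0 mulf_neq0 ?pnatr_eq0 // gt_eqF.
  - by rewrite -dvdp_XsubCl XsubC_dvd // m1.
  - by rewrite /h opprD addrCA subrr addr0.
rewrite -/(A t) normrM normrN hE => hA.
have xyE : ((x t) ^t* *m y t) 0 0 = (complex.Re (((x t) ^t* *m y t) 0 0))%:C%C.
  by move: xy0; rewrite ltcE; case: (_ 0 0) => a b /= /andP[/eqP -> _].
have -> : complex.Re (((x t) ^t* *m y t) 0 0) ^+ 2 *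
      complex.Re (A t / (4%:R * `|r t| ^+ 2)) =
    complex.Re ((complex.Re (((x t) ^t* *m y t) 0 0) ^+ 2)%:C%C *
      (A t / (4%:R * `|r t| ^+ 2))).
  by case: (_ / _) => a b /=; rewrite mul0r subr0.
rewrite rmorphXn /= -xyE.
suff -> : ((x t) ^t* *m y t) 0 0 ^+ 2 * (A t / (4%:R * `|r t| ^+ 2)) =
  (complex.Re (l t) ^+ 2)%:C%C by [].
have gen (a b : Cx R) : b != 0 -> 4%:R * a * b / (4%:R * b) = a.
  by move=> b0; field.
rewrite mulrA [_ * A t]mulrC -[X in X ^+ 2](gtr0_norm xy0) hA -[RHS](gen _ (`|r t| ^+ 2)).
  congr (_ / _); rewrite exprMn; congr (_ * _).
  rewrite -normrX -rmorphXn /= ger0_norm ?(lecR 0) ?sqr_ge0 // sqrrN exprMn.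
  by rewrite rmorphM /= -natrX rmorph_nat.
by rewrite expf_neq0 // normr_eq0.
Unshelve. all: by end_near. Qed.

(** * A quadratic growth law on the line *)

(** L'Hospital's rule for a numerator that need not be defined at a: the mean
    value theorem is used on [s, t], and s then tends to a. *)
Lemma cvg_right_quotient (R : realType) (a b l : R) (g dg : R -> R) :
  a < b -> (forall t, a < t < b -> is_derive t 1 g (dg t)) ->
  g t @[t --> a^'+] --> 0 -> dg t @[t --> a^'+] --> l ->
  g t / (t - a) @[t --> a^'+] --> l.
Proof.
move=> ab gd g0 dgl; apply/cvgrPdist_le => e e0.
move/cvgrPdist_le: dgl => /(_ _ e0); rewrite near_withinE => -[d /= d0 dP].
near=> t.
have at0 : a < t by near: t; exact: nbhs_right_gt.
have tb : t < b by near: t; exact: nbhs_right_lt.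
have td : t < a + d by near: t; apply: nbhs_right_lt; rewrite ltrDl.
have ta : 0 < t - a by rewrite subr_gt0.
suff : `|l * (t - a) - (g t - 0)| <= e * (t - a).
  rewrite subr0 => h; rewrite -(ler_pM2r ta) -[X in _ * X <= _](gtr0_norm ta) -normrM.
  by rewrite mulrBl divfK // gt_eqF.
have sub : (fun s => `|l * (t - s) - (g t - g s)|) s @[s --> a^'+] -->
    `|l * (t - a) - (g t - 0)|.
  apply: cvg_norm; apply: cvgB; last by apply: cvgB => //; exact: cvg_cst.
  apply: cvgM; first exact: cvg_cst.
  by apply: cvgB; [exact: cvg_cst|apply: cvg_at_right_filter; exact: cvg_id].
apply: (cvgr_to_le sub); near=> s.
have as0 : a < s by near: s; exact: nbhs_right_gt.
have st : s < t by near: s; exact: nbhs_right_lt.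
have [||c cst ->] := @MVT R g dg s t st.
- move=> c; rewrite in_itv /= => /andP[sc ct].
  by apply: gd; rewrite (lt_trans as0) ?(lt_trans ct).
- apply: derivable_within_continuous => c; rewrite in_itv /= => /andP[sc ct].
  by have [|] := gd c; rewrite ?(lt_le_trans as0) ?(le_lt_trans ct).
move: cst; rewrite in_itv /= => /andP[sc ct].
rewrite -mulrBl normrM (gtr0_norm (x := t - s)) ?subr_gt0 //.
apply: (@le_trans _ _ (e * (t - s))).
  rewrite ler_wpM2r ?subr_ge0 ?(ltW st) //; apply: (dP c); last exact: lt_trans sc.
  by rewrite /= distrC gtr0_norm ?subr_gt0 ?(lt_trans as0) // ltrBlDl (lt_trans ct).
by rewrite ler_wpM2l ?(ltW e0) // lerD2l lerN2 ltW.
Unshelve. all: by end_near. Qed.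

Lemma continuous_nonzero_same_sign (R : realType) (a b : R) (h : R -> R) :
  {in `]a, b[, continuous h} -> (forall t, a < t < b -> h t != 0) ->
  forall s t, a < s < b -> a < t < b -> h s < 0 -> h t < 0.
Proof.
move=> hc h0; have ivt u v : a < u -> u < v -> v < b ->
    exists2 c, a < c < b & Num.min (h u) (h v) <= 0 <= Num.max (h u) (h v) -> h c = 0.
  move=> au uv vb.
  case: (boolP (Num.min (h u) (h v) <= 0 <= Num.max (h u) (h v))) => [hle|hn].
    have [|c cuv hc0] := IVT (ltW uv) _ hle.
      apply: continuous_in_subspaceT => c; rewrite inE /= in_itv /= => /andP[uc cv].
      by apply: hc; rewrite in_itv /= (lt_le_trans au) ?(le_lt_trans cv).
    exists c => //; move: cuv; rewrite in_itv /= => /andP[uc cv].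
    by rewrite (lt_le_trans au) ?(le_lt_trans cv).
  by exists u => //; rewrite au (lt_trans uv).
move=> s t /andP[as0 sb] /andP[at0 tb] hs; rewrite ltNge; apply/negP => ht.
have [st|st|st] := ltgtP s t.
- have [c cab cP] := ivt s t as0 st tb; have := h0 c cab; rewrite cP ?eqxx //.
  by rewrite ge_min le_max (ltW hs) ht orbT.
- have [c cab cP] := ivt t s at0 st sb; have := h0 c cab; rewrite cP ?eqxx //.
  by rewrite ge_min le_max (ltW hs) ht orbT.
- by move: hs; rewrite st ltNge ht.
Qed.

(** Only the square of f f' is known to converge, so its sign has to be
    determined first: it is constant by continuity, and if it were negative, f
    would increase towards a, against f --> 0.  Then f f' itself converges, and
    f^2 / (t - a) converges by [cvg_right_quotient]. *)
Lemma sqrt_growth (R : realType) (a b c : R) (f : R -> R) :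
  a < b -> (forall t, a < t < b -> derivable f t 1) ->
  (forall t, a < t < b -> derivable f^`()%classic t 1) ->
  (\forall t \near a^'+, 0 < f t) -> f t @[t --> a^'+] --> 0 -> 0 < c ->
  (f t * f^`()%classic t) ^+ 2 @[t --> a^'+] --> c ->
  exists2 gamma : R, 0 < gamma &
    exists2 o1 : R -> R, o1 t @[t --> a^'+] --> 0 &
      \forall t \near a^'+, f t = gamma * Num.sqrt (t - a) * (1 + o1 t).
Proof.
move=> ab fd f'd fgt0 f0 c0 hc; pose h t := f t * f^`()%classic t.
(* Shrink the interval so that f > 0 and f f' is nonzero throughout. *)
have [b' [ab' b'b] bP] : exists2 b', a < b' /\ b' <= b &
    forall t, a < t < b' -> 0 < f t /\ h t != 0.
  have h20 : \forall t \near a^'+, 0 < h t ^+ 2 by exact: (cvgr_gt c hc).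
  have : \forall t \near a^'+, 0 < f t /\ h t != 0.
    near=> t; split; first by near: t.
    by rewrite -sqrf_eq0 gt_eqF //; near: t.
  rewrite near_withinE => -[d /= d0 dP]; exists (Num.min b (a + d)).
    by rewrite lt_min ab ltrDl d0 ge_min lexx.
  move=> t /andP[at0]; rewrite lt_min => /andP[tb td]; apply: (dP t) => //=.
  by rewrite distrC gtr0_norm ?subr_gt0 // ltrBlDl.
have hcont : {in `]a, b'[, continuous h}.
  move=> t; rewrite in_itv /= => /andP[at0 tb].
  have tab : a < t < b by rewrite at0 (lt_le_trans tb).
  apply: cvgM; apply: differentiable_continuous; apply/derivable1_diffP;
    [exact: fd|exact: f'd].
have hpos t : a < t < b' -> 0 < h t.
  move=> tab; have [ft ht] := bP _ tab; rewrite lt_neqAle eq_sym ht /= leNgt.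
  apply/negP => hneg; have /andP[at0 tb] := tab.
  have neg := @continuous_nonzero_same_sign _ _ _ _ hcont (fun t h => (bP t h).2) t _ tab.
  have [] : exists s, [/\ a < s, s < t & f s < f t].
    near (a^'+)%R => s; exists s; split; near: s.
    - exact: nbhs_right_gt.
    - exact: nbhs_right_lt.
    - exact: (cvgr_lt _ f0).
  move=> s [as0 st]; apply/negP; rewrite -leNgt -subr_ge0.
  have [||u] := @MVT R f f^`()%classic s t st.
  - move=> u; rewrite in_itv /= => /andP[su ut].
    rewrite derive1E; apply: derivableP; apply: fd.
    by rewrite (lt_trans as0) // (lt_le_trans _ b'b) // (lt_trans ut).
  - apply: derivable_within_continuous => u; rewrite in_itv /= => /andP[su ut].
    by apply: fd; rewrite (lt_le_trans as0) // (lt_le_trans _ b'b) // (le_lt_trans ut).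
  rewrite in_itv /= => /andP[su ut] /(congr1 -%R); rewrite opprB => ->.
  have uab : a < u < b' by rewrite (lt_trans as0) // (lt_trans ut).
  have := neg u uab hneg; rewrite /h (pmulr_rlt0 _ (bP _ uab).1) => f'u.
  by rewrite -mulNr; apply: mulr_ge0; rewrite ?oppr_ge0 ?subr_ge0 ltW.
pose l := Num.sqrt c; have l0 : 0 < l by rewrite sqrtr_gt0.
have hl : h t @[t --> a^'+] --> l.
  have : Num.sqrt (h t ^+ 2) @[t --> a^'+] --> l.
    by apply: continuous_cvg => //; exact: sqrt_continuous.
  apply: cvg_trans; apply: near_eq_cvg; near=> t; rewrite sqrtr_sqr gtr0_norm //.
  apply: hpos; apply/andP; split; near: t; [exact: nbhs_right_gt|exact: nbhs_right_lt].
have ql : f t ^+ 2 / (t - a) @[t --> a^'+] --> 2 * l.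
  apply: (@cvg_right_quotient _ a b _ (fun t => f t ^+ 2) (fun t => 2 * h t)) => //.
  - move=> t /fd /derivableP ft; rewrite -derive1E in ft.
    have -> : (fun t => f t ^+ 2) = f * f by apply/funext => u; rewrite expr2.
    have -> : 2 * h t = f t *: f^`()%classic t + f t *: f^`()%classic t.
      by rewrite /h mulr_natl mulr2n.
    exact: is_deriveM.
  - have -> : 0 = 0 * 0 :> R by rewrite mulr0.
    by under eq_fun do rewrite expr2; exact: cvgM.
  - by apply: cvgM => //; exact: cvg_cst.
pose gamma := Num.sqrt (2 * l); have gamma0 : 0 < gamma by rewrite sqrtr_gt0 mulr_gt0.
exists gamma => //; exists (fun t => Num.sqrt (f t ^+ 2 / (t - a)) / gamma - 1).
  have -> : 0 = gamma / gamma - 1 by rewrite divff ?subrr // gt_eqF.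
  apply: cvgB; last exact: cvg_cst.
  apply: cvgM; last exact: cvg_cst.
  by apply: continuous_cvg => //; exact: sqrt_continuous.
near=> t.
have at0 : 0 < t - a by rewrite subr_gt0; near: t; exact: nbhs_right_gt.
have ft : 0 < f t by near: t.
rewrite [1 + _]addrC subrK [gamma * _]mulrC -mulrA [gamma * _]mulrCA divff ?gt_eqF // mulr1.
rewrite sqrtrM ?exprn_ge0 ?ltW // sqrtr_sqr gtr0_norm // sqrtrV ?ltW //.
by rewrite mulrCA divff ?mulr1 // gt_eqF // sqrtr_gt0.
Unshelve. all: by end_near. Qed.

(** * Derivatives of matrix curves and of the Hamiltonian maps *)

(** Needed for [invmx], which is a rational function of the entries only near an
    invertible matrix. *)
Lemma near_eq_differentiable (K : numFieldType) (V W : normedModType K)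
    (f g : V -> W) (x : V) :
  (\near x, f x = g x) -> differentiable f x -> differentiable g x.
Proof.
move=> fg fx; have dfc := diff_continuous fx.
have go : g \o shift x = cst (g x) + 'd f x +o_ 0 id.
  apply/eqaddoP => e e0.
  have /eqaddoP /(_ e e0) := diff_locally fx.
  have := fg; rewrite (near_shift 0 x) /= => fg0.
  rewrite -(nbhs_singleton fg).
  apply: filter_app; move: fg0; apply: filterS => z /=.
  by rewrite subr0 !fctE /= => ->.
by apply/diff_locallyP; rewrite (diff_unique dfc go).
Qed.

(** Differentiability of the entries, a form stable under the block operations
    and products that make up the Hamiltonian matrices. *)
Definition mxdiff (K : numFieldType) (V : normedModType K) (m n : nat)
    (f : V -> 'M[K]_(m, n)) (x : V) : Prop :=
  forall i j, differentiable (fun v => f v i j : K) x.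

Lemma differentiable_mx (K : numFieldType) (V : normedModType K) (m n : nat)
    (f : V -> 'M[K]_(m, n)) (x : V) : mxdiff f x -> differentiable f x.
Proof.
move=> fd.
have -> : f = \sum_(i < m) \sum_(j < n) (fun v => f v i j *: delta_mx i j).
  apply/funext => v; rewrite [LHS]matrix_sum_delta fct_sumE; apply: eq_bigr => i _.
  by rewrite fct_sumE.
apply: differentiable_sum => i; apply: differentiable_sum => j.
exact: differentiableZl.
Qed.

Lemma differentiable_sumr (K : numFieldType) (V : normedModType K) (I : finType)
    (f : I -> V -> K) (x : V) :
  (forall i, differentiable (f i) x) -> differentiable (fun v => \sum_i f i v) x.
Proof.
move=> fd; elim: (index_enum I) => [|i s IH].
  by under eq_fun do rewrite big_nil; exact: differentiable_cst.
by under eq_fun do rewrite big_cons; apply: differentiableD.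
Qed.

Lemma differentiable_prodr (K : numFieldType) (V : normedModType K) (I : finType)
    (f : I -> V -> K) (x : V) :
  (forall i, differentiable (f i) x) -> differentiable (fun v => \prod_i f i v) x.
Proof.
move=> fd; elim: (index_enum I) => [|i s IH].
  by under eq_fun do rewrite big_nil; exact: differentiable_cst.
by under eq_fun do rewrite big_cons; apply: differentiableM.
Qed.

Lemma mxdiff_cst (K : numFieldType) (V : normedModType K) (x : V)
    (m n : nat) (A : 'M[K]_(m, n)) : mxdiff (fun=> A) x.
Proof. by move=> i j; exact: differentiable_cst. Qed.

Lemma mxdiffD (K : numFieldType) (V : normedModType K) (x : V)
    (m n : nat) (f g : V -> 'M[K]_(m, n)) :
  mxdiff f x -> mxdiff g x -> mxdiff (fun v => f v + g v) x.
Proof.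
move=> fd gd i j; under eq_fun do rewrite mxE.
by apply: differentiableD; [exact: fd|exact: gd].
Qed.

Lemma mxdiffN (K : numFieldType) (V : normedModType K) (x : V)
    (m n : nat) (f : V -> 'M[K]_(m, n)) :
  mxdiff f x -> mxdiff (fun v => - f v) x.
Proof.
move=> fd i j; under eq_fun do rewrite mxE.
by apply: differentiableN; exact: fd.
Qed.

Lemma mxdiffB (K : numFieldType) (V : normedModType K) (x : V)
    (m n : nat) (f g : V -> 'M[K]_(m, n)) :
  mxdiff f x -> mxdiff g x -> mxdiff (fun v => f v - g v) x.
Proof. by move=> fd gd; apply: mxdiffD => //; exact: mxdiffN. Qed.

Lemma mxdiff_tr (K : numFieldType) (V : normedModType K) (x : V)
    (m n : nat) (f : V -> 'M[K]_(m, n)) :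
  mxdiff f x -> mxdiff (fun v => (f v)^T) x.
Proof. by move=> fd i j; under eq_fun do rewrite mxE; exact: fd. Qed.

Lemma mxdiffM (K : numFieldType) (V : normedModType K) (x : V)
    (m n p : nat) (f : V -> 'M[K]_(m, n)) (g : V -> 'M[K]_(n, p)) :
  mxdiff f x -> mxdiff g x -> mxdiff (fun v => f v *m g v) x.
Proof.
move=> fd gd i j; under eq_fun do rewrite mxE.
by apply: differentiable_sumr => k; apply: differentiableM; [exact: fd|exact: gd].
Qed.

Lemma mxdiff_row (K : numFieldType) (V : normedModType K) (x : V)
    (m n p : nat) (f : V -> 'M[K]_(m, n)) (g : V -> 'M[K]_(m, p)) :
  mxdiff f x -> mxdiff g x -> mxdiff (fun v => row_mx (f v) (g v)) x.
Proof.
move=> fd gd i j; under eq_fun do rewrite mxE.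
by case: (fintype.split j) => k; [exact: fd|exact: gd].
Qed.

Lemma mxdiff_col (K : numFieldType) (V : normedModType K) (x : V)
    (m n p : nat) (f : V -> 'M[K]_(m, p)) (g : V -> 'M[K]_(n, p)) :
  mxdiff f x -> mxdiff g x -> mxdiff (fun v => col_mx (f v) (g v)) x.
Proof.
move=> fd gd i j; under eq_fun do rewrite mxE.
by case: (fintype.split i) => k; [exact: fd|exact: gd].
Qed.

Lemma mxdiff_block (K : numFieldType) (V : normedModType K) (x : V)
    (m n p q : nat) (a : V -> 'M[K]_(m, p)) (b : V -> 'M[K]_(m, q))
    (c : V -> 'M[K]_(n, p)) (d : V -> 'M[K]_(n, q)) :
  mxdiff a x -> mxdiff b x -> mxdiff c x -> mxdiff d x ->
  mxdiff (fun v => block_mx (a v) (b v) (c v) (d v)) x.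
Proof. by move=> *; apply: mxdiff_col; apply: mxdiff_row. Qed.

Lemma differentiable_det (K : numFieldType) (V : normedModType K) (x : V)
    (n : nat) (f : V -> 'M[K]_n) :
  mxdiff f x -> differentiable (fun v => \det (f v) : K) x.
Proof.
move=> fd; apply: differentiable_sumr => s; apply: differentiableM.
  exact: differentiable_cst.
by apply: differentiable_prodr => i; exact: fd.
Qed.

Lemma mxdiff_inv (K : numFieldType) (V : normedModType K) (x : V)
    (n : nat) (f : V -> 'M[K]_n) :
  mxdiff f x -> f x \in unitmx -> mxdiff (fun v => invmx (f v)) x.
Proof.
move=> fd fu i j.
have d0 : \det (f x) != 0 by rewrite -unitfE -unitmxE.
have dd := differentiable_det fd.
apply: (near_eq_differentiable (f := fun v => (\det (f v))^-1 * \adj (f v) i j)).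
  have : \near x, \det (f x) != 0.
    exact: (cvgr_neq0 _ (differentiable_continuous dd) d0).
  apply: filterS => v dv; rewrite /invmx unitmxE unitfE dv.
  by rewrite [RHS]mxE.
apply: differentiableM; first exact: differentiableV.
under eq_fun do rewrite mxE; apply: differentiableM; first exact: differentiable_cst.
by apply: differentiable_det => a b; under eq_fun do rewrite !mxE; exact: fd.
Qed.

Lemma posdefmx_unit (R : realType) (n : nat) (Q : 'M[R]_n) : posdefmx Q -> Q \in unitmx.
Proof.
move=> [_ Qp]; rewrite -row_free_unit -kermx_eq0; apply/eqP/row_matrixP => i.
rewrite row0; apply/eqP; apply/negP => /negP w0.
have := Qp (row i (kermx Q))^T; rewrite trmx_eq0 w0 => /(_ isT).
by rewrite trmxK -row_mul mulmx_ker row0 mul0mx mxE ltxx.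
Qed.

Lemma differentiable_ham_mx (R : realType) (n m p : nat) (K : ham_kind m p)
    (X : 'M[R]_(n + p, n + m)) :
  ham_dom K X -> differentiable (@ham_mx R n m p K) X.
Proof.
move=> dom; apply: differentiable_mx.
have idd (a b : nat) (Y : 'M[R]_(a, b)) : mxdiff (fun v => v) Y.
  by move=> i j; exact: differentiable_coord.
have dul (a b c d : nat) (Y : 'M[R]_(a + b, c + d)) : mxdiff ulsubmx Y.
  by move=> i j; under eq_fun do rewrite !mxE; exact: idd.
have dur (a b c d : nat) (Y : 'M[R]_(a + b, c + d)) : mxdiff ursubmx Y.
  by move=> i j; under eq_fun do rewrite !mxE; exact: idd.
have ddl (a b c d : nat) (Y : 'M[R]_(a + b, c + d)) : mxdiff dlsubmx Y.
  by move=> i j; under eq_fun do rewrite !mxE; exact: idd.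
have ddr (a b c d : nat) (Y : 'M[R]_(a + b, c + d)) : mxdiff drsubmx Y.
  by move=> i j; under eq_fun do rewrite !mxE; exact: idd.
case: K X dom => [q|q r] X /= /posdefmx_unit un; rewrite /ham_p /ham_b.
- apply: mxdiffB.
    by apply: mxdiff_block; [|exact: mxdiff_cst|exact: mxdiff_cst
      |apply: mxdiffN; apply: mxdiff_tr].
  apply: mxdiffM; last by apply: mxdiff_tr; apply: mxdiff_col => //; exact: mxdiff_tr.
  apply: mxdiffM.
    by apply: mxdiff_col => //; apply: mxdiffN; exact: mxdiff_tr.
  by apply: mxdiff_inv => //; apply: mxdiffD => //; exact: mxdiff_tr.
- have dCD : mxdiff (fun Y : 'M[R]_(n + r, n + q) => (dlsubmx Y)^T *m drsubmx Y) X.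
    by apply: mxdiffM => //; exact: mxdiff_tr.
  apply: mxdiffD.
    apply: mxdiff_block; [exact: dul|exact: mxdiff_cst| |].
      by apply: mxdiffN; apply: mxdiffM => //; exact: mxdiff_tr.
    by apply: mxdiffN; exact: mxdiff_tr.
  apply: mxdiffM; last by apply: mxdiff_tr; apply: mxdiff_col.
  apply: mxdiffM; first by apply: mxdiff_col => //; exact: mxdiffN.
  apply: mxdiff_inv => //; apply: mxdiffB; first exact: mxdiff_cst.
  by apply: mxdiffM => //; exact: mxdiff_tr.
Qed.



Lemma is_derive_quotient (R : realType) (V : normedModType R) (u : R -> V) (t : R)
    (du : V) :
  is_derive t 1 u du <-> (fun h : R => h^-1 *: (u (h + t) - u t)) @ 0^' --> du.
Proof.
have e : (fun h : R => h^-1 *: ((u \o shift t) (h *: (1 : R)) - u t)) =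
    (fun h : R => h^-1 *: (u (h + t) - u t)).
  by apply/funext => h; rewrite /= [h *: 1]mulr1.
split=> [|udu]; last first.
  by rewrite -e in udu; apply: DeriveDef; [apply/cvg_ex; exists du|apply: cvg_lim].
move=> [/cvg_ex [du' ud] <-].
have -> : 'D_1 u t = du' by apply: cvg_lim.
by rewrite -e.
Qed.

Definition mxderiv (R : realType) (m n : nat) (u : R -> 'M[R]_(m, n)) (t : R)
    (du : 'M[R]_(m, n)) : Prop :=
  mxcvg (0 : R)^' (fun h : R => h^-1 *: (u (h + t) - u t)) du.

Lemma mxderivP (R : realType) (m n : nat) (u : R -> 'M[R]_(m, n)) (t : R)
    (du : 'M[R]_(m, n)) : mxderiv u t du <-> is_derive t 1 u du.
Proof.
by split=> [/mxcvgP/is_derive_quotient|/is_derive_quotient ud]; last exact/mxcvgP.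
Qed.

Lemma mxderiv_entry (R : realType) (m n : nat) (u : R -> 'M[R]_(m, n)) (t : R)
    (du : 'M[R]_(m, n)) :
  mxderiv u t du <-> forall i j, is_derive t 1 (fun s => u s i j) (du i j).
Proof.
split=> ud i j; last first.
  have /is_derive_quotient := ud i j.
  by under [in X in _ -> X]eq_fun do rewrite !mxE.
apply/is_derive_quotient; have := ud i j.
by under [in X in X -> _]eq_fun do rewrite !mxE.
Qed.

Lemma mxderiv_cvg (R : realType) (m n : nat) (u : R -> 'M[R]_(m, n)) (t : R)
    (du : 'M[R]_(m, n)) :
  mxderiv u t du -> mxcvg (0 : R)^' (fun h => u (h + t)) (u t).
Proof.
move=> ud; apply/mxcvgP.
have /mxderivP[/derivable1_diffP/differentiable_continuous uc _] := ud.
apply: cvg_within_filter.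
have ht : h + t @[h --> (0 : R)] --> 0 + t.
  by apply: cvgD; [exact: cvg_id|exact: cvg_cst].
rewrite add0r in ht.
exact: (cvg_comp _ _ ht uc).
Qed.

Lemma mxderiv_linear (R : realType) (a b c d : nat)
    (L : {linear 'M[R]_(a, b) -> 'M[R]_(c, d)}) (X : 'M[R]_(c, d))
    (u : R -> 'M[R]_(a, b)) (t : R) (du : 'M[R]_(a, b)) :
  mxderiv u t du -> mxderiv (fun s => X + L (u s)) t (L du).
Proof.
move=> ud; rewrite /mxderiv.
have -> : (fun h : R => h^-1 *: (X + L (u (h + t)) - (X + L (u t)))) =
    (fun h => L (h^-1 *: (u (h + t) - u t))).
  by apply/funext => h; rewrite opprD addrACA subrr add0r -(raddfB L) [RHS]linearZ.
have LE (Y : 'M[R]_(a, b)) i j : (L Y) i j = \sum_k \sum_l Y k l * L (delta_mx k l) i j.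
  rewrite {1}(matrix_sum_delta Y) linear_sum summxE; apply: eq_bigr => k _.
  rewrite linear_sum summxE; apply: eq_bigr => l _.
  by rewrite linearZ mxE.
move=> i j; rewrite LE; under eq_fun do rewrite LE.
by apply: cvg_sumr => k; apply: cvg_sumr => l; apply: cvgM; [exact: ud|exact: cvg_cst].
Qed.

Lemma mxderiv_ham_mx (R : realType) (n m p : nat) (K : ham_kind m p)
    (u : R -> 'M[R]_(n + p, n + m)) (t : R) (du : 'M[R]_(n + p, n + m)) :
  ham_dom K (u t) -> mxderiv u t du ->
  mxderiv (fun s => ham_mx K (u s)) t ('d (@ham_mx R n m p K) (u t) du).
Proof.
move=> /differentiable_ham_mx dK /mxderivP [/derivable1_diffP du' <-].
apply/mxderivP; have dc := differentiable_comp du' dK.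
apply: DeriveDef; first exact/derivable1_diffP.
by rewrite deriveE // diff_comp // deriveE.
Qed.

(** * Frobenius geometry and the stationarity condition *)

Lemma frobE (R : realType) (k l : nat) (U V : 'M[R]_(k, l)) :
  frob U V = \sum_i \sum_j U i j * V i j.
Proof.
rewrite /frob /mxtrace exchange_big /=; apply: eq_bigr => j _.
by rewrite mxE; apply: eq_bigr => i _; rewrite mxE.
Qed.

Lemma frobC (R : realType) (k l : nat) (U V : 'M[R]_(k, l)) : frob U V = frob V U.
Proof. by rewrite /frob -mxtrace_tr trmx_mul trmxK. Qed.

Lemma frobDl (R : realType) (k l : nat) (U V W : 'M[R]_(k, l)) :
  frob (U + V) W = frob U W + frob V W.
Proof. by rewrite /frob linearD /= mulmxDl linearD. Qed.

Lemma frobZl (R : realType) (k l : nat) (a : R) (U W : 'M[R]_(k, l)) :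
  frob (a *: U) W = a * frob U W.
Proof. by rewrite /frob linearZ /= -scalemxAl linearZ. Qed.

Lemma frobDr (R : realType) (k l : nat) (U V W : 'M[R]_(k, l)) :
  frob W (U + V) = frob W U + frob W V.
Proof. by rewrite frobC frobDl !(frobC W). Qed.

Lemma frobZr (R : realType) (k l : nat) (a : R) (U W : 'M[R]_(k, l)) :
  frob W (a *: U) = a * frob W U.
Proof. by rewrite frobC frobZl frobC. Qed.

Lemma frob_gt0 (R : realType) (k l : nat) (U : 'M[R]_(k, l)) : U != 0 -> 0 < frob U U.
Proof.
move=> U0; rewrite frobE lt_neqAle eq_sym; apply/andP; split; last first.
  by apply: sumr_ge0 => i _; apply: sumr_ge0 => j _; rewrite -expr2 sqr_ge0.
apply: contraNneq U0 => /eqP.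
rewrite psumr_eq0 => [/allP U0|i _]; last first.
  by apply: sumr_ge0 => j _; rewrite -expr2 sqr_ge0.
apply/eqP/matrixP => i j; rewrite mxE.
have := U0 i (mem_index_enum _); rewrite /= psumr_eq0 => [/allP|? _]; last first.
  by rewrite -expr2 sqr_ge0.
by move=> /(_ j (mem_index_enum _)); rewrite /= mulf_eq0 orbb => /eqP.
Qed.


(** Both adjoints are moved to the other side of the inner product; what remains
    is <N', Re (x y^* )> = Re (x^* N' y). *)
Lemma frob_gradG (R : realType) (n m p k l : nat) (K : ham_kind m p)
    (X : 'M[R]_(n + p, n + m)) (L : {linear 'M[R]_(k, l) -> 'M[R]_(n + p, n + m)})
    (e : R) (E Z : 'M[R]_(k, l)) (x y : 'cV[R[i]]_(n + n)) :
  frob Z (gradG K X L e E x y) =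
  complex.Re ((x ^t* *m cplxmx ('d (@ham_mx R n m p K) (X + L (e *: E)) (L Z)) *m y) 0 0).
Proof.
rewrite /gradG -!frob_adjmx; set W : 'M[R]_(n + n) := 'd _ _ _.
have ReD (I : finType) (f : I -> R[i]) : complex.Re (\sum_i f i) = \sum_i complex.Re (f i).
  by apply: (big_morph (@complex.Re R)) => // -[? ?] [? ?].
rewrite /frob /mxtrace mxE ReD; apply: eq_bigr => j _.
rewrite !mxE mulr_suml ReD; apply: eq_bigr => i _.
rewrite !mxE big_ord1 !mxE.
by case: (x i 0) (y j 0) => [a b] [c d] /=; ring.
Qed.

Lemma cnorm1_sum (R : realType) (n : nat) (v : 'cV[R[i]]_n) :
  cnorm v = 1 -> \sum_i `|v i 0| ^+ 2 = 1.
Proof.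
rewrite /cnorm => /(congr1 (fun a => a ^+ 2)).
rewrite sqr_sqrtr ?expr1n; last by apply: sumr_ge0 => i _; rewrite sqr_ge0.
move=> /(congr1 (real_complex R)); rewrite rmorph1 => <-.
rewrite rmorph_sum; apply: eq_bigr => i _.
by rewrite [in LHS]normc_def [in RHS]normc_def -rmorphXn.
Qed.

Lemma alg_mult_gt0_dim (R : realType) (q : nat) (N : 'M[R]_q) (mu : R[i]) :
  (0 < alg_mult N mu)%N -> (0 < q)%N.
Proof.
case: q N => // N; rewrite /alg_mult; set P := char_poly _.
have /eqP/size_poly1P [c c0 ->] : size P = 1%N by rewrite size_char_poly.
by rewrite mupNroot // rootC.
Qed.

Lemma lead_eig_root (R : realType) (n : nat) (N : 'M[R]_(n + n)) :
  (0 < n)%N -> hamiltonian N ->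
  root (char_poly (cplxmx N)) (lead_eig N).
Proof. by move=> n0 /(lead_eigP n0) []; rewrite eigenvalue_root_char. Qed.

(** Real form of [eigenvalue_difference_quotient], for a filter F on the
    increments: two-sided for the derivative along e, one-sided for competitors
    of a maximizer. *)
Lemma cvg_Re_eigenvalue_quotient (R : realType) (F : set_system R) (FF : ProperFilter F)
    (q : nat)
    (N : R -> 'M[R]_q) (t0 : R) (dN : 'M[R]_q) (mu : R -> R[i]) (l : R[i])
    (x y : 'cV[R[i]]_q) :
  F `=>` (0 : R)^' -> mxderiv N t0 dN ->
  (mu : R -> Cx R) h @[h --> F] --> (l : Cx R) ->
  (\forall h \near F, root (char_poly (cplxmx (N (h + t0)))) (mu h)) ->
  normalized_eigenpair (N t0) l x y -> alg_mult (N t0) l = 1%N ->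
  h^-1 * (complex.Re (mu h) - complex.Re l) @[h --> F] -->
  complex.Re ((x ^t* *m cplxmx dN *m y) 0 0) / complex.Re ((x ^t* *m y) 0 0).
Proof.
move=> F0 Nd mul nr [xN Ny _ _ xy0] m1.
have c0 : (char_poly (cplxmx (N t0)))^`().[l] != 0.
  have := nderivn_mup (l : Cx R)
    (monic_neq0 (char_poly_monic (cplxmx (N t0) : 'M[Cx R]_q))).
  by rewrite [mup _ _]m1 nderivn1.
have Nc : mxcvg F (fun h => cplxmx (N (h + t0)) : 'M[Cx R]_q) (cplxmx (N t0)).
  by apply: mxcvg_complex => i j; exact: (sub_mxcvg F0 (mxderiv_cvg Nd)).
have sN : mxcvg F (fun h => (h^-1)%:C%C *: (cplxmx (N (h + t0)) - cplxmx (N t0)) :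
    'M[Cx R]_q) (cplxmx dN).
  have <- : (fun h => cplxmx (h^-1 *: (N (h + t0) - N t0)) : 'M[Cx R]_q) =
      (fun h => (h^-1)%:C%C *: (cplxmx (N (h + t0)) - cplxmx (N t0)) : 'M[Cx R]_q).
    by apply/funext => h; apply/matrixP => i j; rewrite !mxE rmorphM rmorphB.
  by apply: mxcvg_complex; exact: (sub_mxcvg F0 Nd).
have xy0' : (x ^t* *m y) 0 0 != 0 by rewrite gt_eqF.
have FF' : Filter F by exact: filter_filter.
have Q := @eigenvalue_difference_quotient (Cx R) R F FF' q _ _ _ _ _ _ _ _ Nc sN mul nr
  xN Ny c0 xy0'.
have {Q} := @cvg_Re R R F FF' _ _ Q.
have -> : (fun h : R => complex.Re ((h^-1)%:C%C * (mu h - l) : Cx R)) =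
    (fun h => h^-1 * (complex.Re (mu h) - complex.Re l)).
  apply/funext => h; case: (mu h) l {mul nr c0 m1 xN Ny} => [a b] [c d] /=.
  by rewrite mul0r subr0.
have -> // : complex.Re ((x ^t* *m cplxmx dN *m y) 0 0 / (x ^t* *m y) 0 0 : Cx R) =
   complex.Re ((x ^t* *m cplxmx dN *m y) 0 0) / complex.Re ((x ^t* *m y) 0 0).
have -> : (x ^t* *m y) 0 0 = (complex.Re ((x ^t* *m y) 0 0))%:C%C.
  by move: xy0; rewrite ltcE; case: (_ 0 0) => a b /= /andP[/eqP -> _].
rewrite -fmorphV /=; case: (_ 0 0) => a b /=; ring.
Qed.

(** If G is not parallel to E, let Z be its normalized component orthogonal to
    E, and move along the great circle cos t E + sin t Z.  For t > 0 the leading eigenvalue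
    stays in the strip 0 <= Re <= Re lam by maximality, hence converges to lam,
    and its difference quotient tends to e <Z, G> / (x^* y) > 0, while maximality
    makes it nonpositive. *)
Lemma maximizer_gradient_parallel (R : realType) (n m p k l : nat) (K : ham_kind m p)
    (X : 'M[R]_(n + p, n + m)) (L : {linear 'M[R]_(k, l) -> 'M[R]_(n + p, n + m)})
    (e : R) (E : 'M[R]_(k, l)) (x y : 'cV[R[i]]_(n + n)) (lam : R[i]) :
  let N := Mpert K X L e E in let G := gradG K X L e E x y in
  (0 < n)%N -> 0 < e -> lam = lead_eig N -> ham_dom K (X + L (e *: E)) ->
  sphere_local_max (phi K X L e) E -> normalized_eigenpair N lam x y ->
  alg_mult N lam = 1%N ->
  (forall mu, eigenvalue (cplxmx N) mu -> complex.Re mu != 0) ->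
  (forall mu, eigenvalue (cplxmx N) mu -> 0 < complex.Re mu -> 0 <= complex.Im mu ->
     complex.Re mu <= complex.Re lam -> mu = lam) ->
  G = frob E G *: E.
Proof.
move=> N G n0 e0 lamE dom [E1 Emax] xyN m1 noim uniq_lam.
have EE : frob E E = 1.
  have := congr1 (fun a => a ^+ 2) E1; rewrite /fnorm sqr_sqrtr ?expr1n //.
  by rewrite frobE; apply: sumr_ge0 => i _; apply: sumr_ge0 => j _; rewrite -expr2 sqr_ge0.
apply/eqP; rewrite -subr_eq0; apply/negPn/negP => Z0.
set Z' := G - _ in Z0; pose z := Num.sqrt (frob Z' Z'); pose Z := z^-1 *: Z'.
have z0 : 0 < z by rewrite sqrtr_gt0 frob_gt0.
have zz : z ^+ 2 = frob Z' Z' by rewrite sqr_sqrtr // ltW // frob_gt0.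
have EZ' : frob E Z' = 0 by rewrite /Z' -scaleNr frobDr frobZr EE mulr1 subrr.
have EZ : frob E Z = 0 by rewrite frobZr EZ' mulr0.
have ZZ : frob Z Z = 1.
  by rewrite frobZl frobZr -zz mulrA -expr2 -exprMn mulVf ?expr1n // gt_eqF.
have ZG : frob Z G = z.
  have -> : G = Z' + frob E G *: E by rewrite subrK.
  rewrite frobDr frobZr (frobC Z E) EZ mulr0 addr0 frobZl -zz expr2 mulrA mulVf ?mul1r //.
  by rewrite gt_eqF.
clearbody Z.
pose a t : 'M[R]_(k, l) := cos t *: E + sin t *: Z.
have a0 : a 0 = E by rewrite /a cos0 sin0 scale1r scale0r addr0.
have aN t : fnorm (a t) = 1.
  rewrite /fnorm /a frobDl !frobZl !frobDr !frobZr EE ZZ EZ (frobC Z E) EZ.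
  by rewrite !mulr0 addr0 add0r !mulr1 -!expr2 cos2Dsin2 sqrtr1.
have ad c : mxderiv (fun t => c *: a t) 0 (c *: Z).
  apply/mxderiv_entry => i j; rewrite mxE.
  have -> : (fun s : R => (c *: a s) i j) =
      (c * E i j) \*: (@cos R) + (c * Z i j) \*: (@sin R).
    by apply/funext => s; rewrite !mxE /=; rewrite fctE /= /GRing.scale /=; ring.
  apply: is_derive_eq; rewrite sin0 cos0 oppr0 scaler0 add0r /GRing.scale /= mulr1 //.
have Nd W : a 0 = W -> mxderiv (fun t => Mpert K X L e (a t)) 0
    ('d (@ham_mx R n m p K) (X + L (e *: W)) (L (e *: Z))).
  move=> <-; apply: (@mxderiv_ham_mx _ _ _ _ K (fun t => X + L (e *: a t))).
    by rewrite a0.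
  exact: mxderiv_linear.
have {}Nd := Nd E a0.
have ac : a t @[t --> (0 : R)^'] --> E.
  have := ad 1 => /mxderiv_cvg /mxcvgP; under eq_fun do rewrite scale1r addr0.
  by rewrite scale1r a0.
have r0 : (0 : R)^'+ `=>` (0 : R)^'.
  move=> B; rewrite /dnbhs /at_right /within /=; apply: filterS => h Bh h0.
  by apply: Bh; rewrite /= gt_eqF.
pose mu h := lead_eig (Mpert K X L e (a h)).
have mu_le : \forall h \near (0 : R)^'+, complex.Re (mu h) <= complex.Re lam.
  have acE : \forall h \near (0 : R)^', fnorm (a h) = 1 ->
      phi K X L e (a h) <= phi K X L e E := ac _ Emax.
  have := r0 _ acE; apply: filterS => h /=; rewrite lamE; apply; exact: aN.
have muP h : is_lead_eig (Mpert K X L e (a h)) (mu h).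
  by apply: lead_eigP => //; exact: ham_mx_hamiltonian.
have muc : (mu : R -> Cx R) h @[h --> (0 : R)^'+] --> (lam : Cx R).
  apply: (@cvg_root_in_strip R R _ _ _ (complex.Re lam)
     (fun h => cplxmx (Mpert K X L e (a h))) (cplxmx N)).
  - apply: mxcvg_complex; apply: (sub_mxcvg r0); have := mxderiv_cvg Nd.
    by rewrite a0; under eq_fun do rewrite addr0.
  - move: mu_le; apply: filterS => h mul; have [me m0 mi _] := muP h.
    by split => //; rewrite -eigenvalue_root_char.
  - exact: m1.
  - move=> w; rewrite -eigenvalue_root_char => we w0 wl wi; apply: uniq_lam => //.
    by rewrite lt_neqAle w0 eq_sym noim.
have nr : \forall h \near (0 : R)^'+,
    root (char_poly (cplxmx (Mpert K X L e (a (h + 0))))) (mu h).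
  by near=> h; rewrite addr0; have [me _ _ _] := muP h; rewrite -eigenvalue_root_char.
have xyN0 : normalized_eigenpair (Mpert K X L e (a 0)) lam x y by rewrite a0.
have m10 : alg_mult (Mpert K X L e (a 0)) lam = 1%N by rewrite a0.
have Q := cvg_Re_eigenvalue_quotient (at_right_proper_filter (0 : R)) r0 Nd muc nr xyN0 m10.
rewrite -frob_gradG frobZl -/G ZG in Q.
have : e * z / complex.Re ((x ^t* *m y) 0 0) <= 0.
  apply: (cvgr_to_le Q); near=> h.
  have h0 : 0 < h by near: h; exact: nbhs_right_gt.
  rewrite pmulr_rle0 ?invr_gt0 // subr_le0; near: h; exact: mu_le.
apply/negP; rewrite -ltNge divr_gt0 // ?mulr_gt0 //.
by case: xyN => _ _ _ _; rewrite ltcE => /andP[].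
Unshelve. all: by end_near. Qed.

(** * The square root law *)

Local Close Scope sesquilinear_scope.

Theorem theorem3p3 (R : realType) (n m p k l : nat) (K : ham_kind m p)
    (A : 'M[R]_n) (B : 'M[R]_(n, m)) (C : 'M[R]_(p, n)) (D : 'M[R]_(p, m))
    (L : {linear 'M[R]_(k, l) -> 'M[R]_(n + p, n + m)})
    (E : R -> 'M[R]_(k, l)) (ehat ebar : R)
    (x y : R -> 'cV[R[i]]_(n + n))
    (S : R -> 'M[R]_(n + n)) (F H : R -> 'M[R]_n)
    (Mhat : 'M[R]_(n + n)) (lamhat : R[i]) (Ghat : 'M[R]_(k, l)) :
  let X := block_mx A B C D in
  let M := fun e => Mpert K X L e (E e) in
  let lam := fun e => lead_eig (M e) in
  let f := fun e => phi K X L e (E e) in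
  let G := fun e => gradG K X L e (E e) (x e) (y e) in
  (forall mu : R[i], eigenvalue (cplxmx A) mu -> complex.Re mu < 0) ->
  ham_dom K X ->
  0 <= ehat -> ehat < ebar ->
  (forall e, 0 < e < ebar -> ham_dom K (X + L (e *: E e))) ->
  (forall e, 0 < e < ebar -> sphere_local_max (phi K X L e) (E e)) ->
  (forall e, 0 < e <= ehat -> f e = 0) ->
  (\forall e \near ehat^'+, 0 < f e) ->
  f e @[e --> ehat^'+] --> 0 ->
  (forall e, ehat < e < ebar ->
     normalized_eigenpair (M e) (lam e) (x e) (y e)) ->
  (forall e, ehat < e < ebar ->
     [/\ 0 < complex.Re (lam e),
         alg_mult (M e) (lam e) = 1%N &
         forall mu : R[i], eigenvalue (cplxmx (M e)) mu ->
           0 < complex.Re mu -> 0 <= complex.Im mu ->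
           complex.Re mu <= complex.Re (lam e) -> mu = lam e]) ->
  smooth_on E ehat ebar ->
  smooth_on (fun e => complex.Re (lam e)) ehat ebar ->
  smooth_on (fun e => complex.Im (lam e)) ehat ebar ->
  (forall e, ehat < e < ebar -> G e != 0) ->
  M e @[e --> ehat^'+] --> Mhat ->
  complex.Re (lam e) @[e --> ehat^'+] --> complex.Re lamhat ->
  complex.Im (lam e) @[e --> ehat^'+] --> complex.Im lamhat ->
  complex.Re lamhat = 0 ->
  alg_mult Mhat lamhat = 2%N ->
  defective Mhat lamhat ->
  (forall e, ehat < e < ebar ->
     [/\ (forall mu : R[i], eigenvalue (cplxmx (M e)) mu -> complex.Re mu != 0),
         schur_hamiltonian (M e) (S e) (F e) (H e) &
         eigenvalue (cplxmx (F e)) (lam e)]) ->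
  (0%:E < limf_einf (fun e => (nondeg (S e) (x e))%:E) (ehat^'+))%E ->
  G e @[e --> ehat^'+] --> Ghat ->
  Ghat != 0 ->
  exists2 gamma : R, 0 < gamma &
    exists2 o1 : R -> R, o1 e @[e --> ehat^'+] --> 0 &
      \forall e \near ehat^'+,
        complex.Re (lam e) = gamma * Num.sqrt (e - ehat) * (1 + o1 e).
Proof.
move=> X M lam f G _ _ ehat0 eb dom Emax _ fpos f0 xyN lamP Esm rsm ism _ Mc rc ic
  rl0 m2 def noim _ Gc G0.
have n0 : (0 < n)%N.
  have e1 : ehat < (ehat + ebar) / 2 < ebar by rewrite midf_lt // midf_lt.
  have [_ m1 _] := lamP _ e1.
  have /alg_mult_gt0_dim :
      (0 < alg_mult (M ((ehat + ebar) / 2)) (lam ((ehat + ebar) / 2)))%N.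
    by rewrite m1.
  by rewrite addn_gt0 orbb.
have ham e : hamiltonian (M e) by exact: ham_mx_hamiltonian.
have pos e : ehat < e < ebar -> 0 < e < ebar.
  by move=> /andP[he eb']; rewrite eb' (le_lt_trans ehat0).
have par e : ehat < e < ebar -> G e = frob (E e) (G e) *: E e.
  move=> ee; have /andP[e0 _] := pos _ ee.
  have [ni _ _] := noim _ ee; have [_ m1 uni] := lamP _ ee.
  exact: (maximizer_gradient_parallel n0 e0 erefl (dom _ (pos _ ee)) (Emax _ (pos _ ee))
    (xyN _ ee) m1 ni uni).
pose r e := complex.Re (((x e) ^t* *m y e)%sesqui 0 0).
have r_gt0 e : ehat < e < ebar -> 0 < r e.
  by move=> ee; have [_ _ _ _] := xyN _ ee; rewrite ltcE => /andP[].
have EE e : ehat < e < ebar -> frob (E e) (E e) = 1.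
  move=> ee; have [+ _] := Emax _ (pos _ ee); move=> /(congr1 (fun a => a ^+ 2)).
  rewrite /fnorm sqr_sqrtr ?expr1n //.
  by rewrite frobE; apply: sumr_ge0 => i _; apply: sumr_ge0 => j _; rewrite -expr2 sqr_ge0.
have openI e : ehat < e < ebar -> \forall s \near e, ehat < s < ebar.
  by move=> ee; exact: near_in_itvoo.
(* The derivative of f is <G, E> / r: the term <G, E'> vanishes since G is
   parallel to E and E stays on the unit sphere. *)
have fd e : ehat < e < ebar -> is_derive e 1 f (frob (E e) (G e) / r e).
  move=> ee; apply/is_derive_quotient.
  have Ed : is_derive e 1 E ('D_1 E e) by apply: derivableP; exact: (Esm 0%N).
  set dE := 'D_1 E e in Ed.
  have Eij i j : is_derive e 1 (fun s => E s i j) (dE i j).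
    by move/mxderivP/mxderiv_entry : Ed; apply.
  have ad : mxderiv (fun s => s *: E s) e (E e + e *: dE).
    apply/mxderiv_entry => i j.
    have -> : (fun s : R => (s *: E s) i j) = id * (fun s => E s i j).
      by apply/funext => s; rewrite mxE.
    apply: is_derive_eq; rewrite !mxE /GRing.scale /=; ring.
  have EdE : frob (E e) dE = 0.
    have : is_derive e 1 (fun s => frob (E s) (E s)) (2 * frob (E e) dE).
      have -> : (fun s => frob (E s) (E s)) =
          \sum_i \sum_j ((fun s => E s i j) * (fun s => E s i j)).
        apply/funext => s; rewrite frobE fct_sumE; apply: eq_bigr => i _.
        by rewrite fct_sumE.
      have -> : 2 * frob (E e) dE = \sum_i \sum_j (E e i j *: dE i j + E e i j *: dE i j).
        rewrite frobE mulr_sumr; apply: eq_bigr => i _; rewrite mulr_sumr.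
        by apply: eq_bigr => j _; rewrite mulr_natl mulr2n.
      by apply: is_derive_sum => i; apply: is_derive_sum => j; exact: is_deriveM.
    move=> [_ D1].
    have : 'D_1 (fun s => frob (E s) (E s)) e = 'D_1 (cst (1 : R)) e.
      by apply: near_eq_derive; have := openI _ ee; apply: filterS => s /EE.
    rewrite D1 derive_cst => /eqP; rewrite mulf_eq0 pnatr_eq0 /=.
    by move/eqP.
  have Md : mxderiv M e ('d (@ham_mx R n m p K) (X + L (e *: E e)) (L (E e + e *: dE))).
    by apply: (@mxderiv_ham_mx _ _ _ _ K (fun s => X + L (s *: E s)));
      [exact: dom (pos _ ee)|exact: mxderiv_linear].
  have lamc : (fun h => lam (h + e) : Cx R) h @[h --> (0 : R)^'] --> (lam e : Cx R).
    have c g : derivable g e 1 -> (g (h + e) : R) @[h --> (0 : R)^'] --> g e.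
      move=> /derivable1_diffP/differentiable_continuous gc; apply: cvg_within_filter.
      have ht : h + e @[h --> (0 : R)] --> 0 + e.
        by apply: cvgD; [exact: cvg_id|exact: cvg_cst].
      by rewrite add0r in ht; exact: (cvg_comp _ _ ht gc).
    apply: cvg_complex; [exact: (c _ (rsm 0%N e ee))|exact: (c _ (ism 0%N e ee))].
  have nr : \forall h \near (0 : R)^', root (char_poly (cplxmx (M (h + e)))) (lam (h + e)).
    by near=> h; exact: lead_eig_root.
  have [_ m1 _] := lamP _ ee.
  have := cvg_Re_eigenvalue_quotient (Proper_dnbhs_numFieldType (0 : R)) (fun=> id)
    Md lamc nr (xyN _ ee) m1.
  rewrite -frob_gradG -/(G e) -/(r e) [X in X / r e](_ : _ = frob (E e) (G e)) //.
  rewrite frobDl frobZl {2}(par _ ee) frobZr (frobC dE) EdE.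
  by rewrite !mulr0 addr0.
have near_itv : \forall e \near ehat^'+, ehat < e < ebar.
  near=> e; apply/andP; split; near: e; [exact: nbhs_right_gt|exact: nbhs_right_lt].
have [Q [q q0 Qq] Qr] : exists2 Q : R -> R,
    exists2 q : R, 0 < q & Q e @[e --> ehat^'+] --> q &
    \forall e \near ehat^'+, complex.Re (lam e) ^+ 2 = r e ^+ 2 * Q e.
  apply: (@overlap_asymptotics R R ehat^'+ _ (n + n) (fun e => cplxmx (M e)) (cplxmx Mhat)
    lam lamhat x y) => //.
  - by apply: mxcvg_complex; apply/mxcvgP.
  - exact: cvg_complex.
  - by move: def; rewrite /defective m2.
  - near=> e; have ee : ehat < e < ebar by near: e.
    have [l0 m1 _] := lamP _ ee; split=> //.
    rewrite -eigenvalue_root_char; apply: eigenvalue_cplxmx_opp => //.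
    by apply: eigenvalue_cplxmx_conj; rewrite eigenvalue_root_char; exact: lead_eig_root.
  - near=> e; have ee : ehat < e < ebar by near: e.
    by have [? ? /cnorm1_sum ? /cnorm1_sum ? ?] := xyN _ ee; split.
have fE e : ehat < e < ebar -> f^`()%classic e = frob (E e) (G e) / r e.
  by move=> /fd fde; rewrite derive1E derive_val.
apply: (@sqrt_growth R ehat ebar (q * frob Ghat Ghat)) => //.
- by move=> e ee; exact: (rsm 0%N).
- by move=> e ee; exact: (rsm 1%N).
- by rewrite mulr_gt0 // frob_gt0.
(* Since <G, E>^2 = |G|^2, the limit of (f f')^2 is that of Q |G|^2. *)
have : Q e * frob (G e) (G e) @[e --> ehat^'+] --> q * frob Ghat Ghat.
  apply: cvgM => //; rewrite frobE; under eq_fun do rewrite frobE.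
  apply: cvg_sumr => i; apply: cvg_sumr => j.
  by move/mxcvgP: Gc => Gc; apply: cvgM; exact: Gc.
apply: cvg_trans; apply: near_eq_cvg; near=> e.
have ee : ehat < e < ebar by near: e.
have Qe : complex.Re (lam e) ^+ 2 = r e ^+ 2 * Q e by near: e.
have re0 : r e != 0 by rewrite gt_eqF // r_gt0.
have GG : frob (G e) (G e) = frob (E e) (G e) ^+ 2.
  by rewrite {1 2}(par _ ee) frobZl frobZr EE // mulr1 expr2.
rewrite fE // GG exprMn exprMn exprVn.
have -> : f e ^+ 2 = r e ^+ 2 * Q e by exact: Qe.
by field.
Unshelve. all: by end_near. Qed.
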